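(* Let $K$ be an algebraically closed field of characteristic zero. Given any finite connected wild quiver $Q$ without oriented cycles, there exists a Schur representation of $Q$ (finite-dimensional over $K$) that is not $\theta$-stable for any weight $\theta\in\mathbb{Z}^{Q_0}$.
   Context: A finite connected acyclic quiver is wild if and only if its underlying graph is neither a Dynkin diagram (types $A,D,E$) nor a Euclidean (extended Dynkin) diagram. A representation $V$ is Schur if $\operatorname{End}_Q(V)\simeq K$. For $\theta,\gamma\in\mathbb{Z}^{Q_0}$ put $\theta(\gamma)=\sum_{x\in Q_0}\theta(x)\gamma(x)$; $\underline{\dim}\,V$ is the dimension vector of $V$. A nonzero representation $V$ is $\theta$-stable if (by King's criterion) $\theta(\underline{\dim}\,V)=0$ and $\theta(\underline{\dim}\,V')<0$ for every proper subrepresentation $0\ne V'<V$. *)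

(* Defs.v *)
From HB Require Import structures.
From mathcomp Require Import all_boot all_order all_algebra.

Set Implicit Arguments.
Unset Strict Implicit.
Unset Printing Implicit Defensive.

Import GRing.Theory Num.Theory.
Local Open Scope ring_scope.

Structure quiver := Quiver {
  vert : finType;
  arrow : finType;
  src : arrow -> vert;
  tgt : arrow -> vert }.

Section Quivers.
Variable Q : quiver.

Definition adjacent : rel (vert Q) := fun x y =>
  [exists a : arrow Q,
    ((src a == x) && (tgt a == y)) || ((src a == y) && (tgt a == x))].

(* The empty quiver does not count as connected. *)
Definition connected_quiver : Prop :=
  (0 < #|vert Q|)%N /\ forall x y : vert Q, connect adjacent x y.

(* [cycle] also closes up from the last arrow to the first one; on a
   singleton [:: a] it says that a is a loop. *)
Definition acyclic_quiver : Prop :=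
  forall c : seq (arrow Q), cycle (fun a b => tgt a == src b) c -> c = [::].

(* A multigraph on the vertices 0, ..., n-1 is given by the list E of its
   edges, in which the order of the two ends of an edge is irrelevant and
   repetitions account for multiple edges. *)
Definition underlying_graph_is (n : nat) (E : seq (nat * nat)) : Prop :=
  exists (f : vert Q -> 'I_n) (g : arrow Q -> 'I_(size E)),
    [/\ bijective f, bijective g
      & forall a : arrow Q,
          let e := nth (0, 0)%N E (g a) in
          e = (val (f (src a)), val (f (tgt a))) \/
          e = (val (f (tgt a)), val (f (src a)))].

End Quivers.

(* The path 0 -- 1 -- ... -- n-1. *)
Definition path_edges (n : nat) : seq (nat * nat) :=
  [seq (i, i.+1) | i <- iota 0 n.-1].

(* Numbering: a path on the vertices 0, 1, 2, ..., followed by the remaining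
   vertices, each joined to an earlier one. *)
Inductive dynkin : nat -> seq (nat * nat) -> Prop :=
| DynkinA n of (1 <= n)%N : dynkin n (path_edges n)
| DynkinD n of (4 <= n)%N :
    dynkin n (rcons (path_edges n.-1) (n - 3, n.-1)%N)
| DynkinE n of (6 <= n <= 8)%N :
    dynkin n (rcons (path_edges n.-1) (2, n.-1)%N).

(* The diagram with subscript n has n+1 vertices.  EuclideanA 0 is one vertex
   with a loop, EuclideanA 1 is a double edge. *)
Inductive euclidean : nat -> seq (nat * nat) -> Prop :=
| EuclideanA n : euclidean n.+1 (rcons (path_edges n.+1) (n, 0)%N)
| EuclideanD n of (4 <= n)%N :
    euclidean n.+1 (path_edges n.-1 ++ [:: (n - 3, n.-1); (1, n)])%N
| EuclideanE6 : euclidean 7 (path_edges 5 ++ [:: (2, 5); (5, 6)])%N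
| EuclideanE7 : euclidean 8 (path_edges 7 ++ [:: (3, 7)])%N
| EuclideanE8 : euclidean 9 (path_edges 8 ++ [:: (2, 8)])%N.

(* This criterion characterizes wildness only for connected acyclic quivers. *)
Definition wild (Q : quiver) : Prop :=
  forall n E, underlying_graph_is Q n E -> ~ dynkin n E /\ ~ euclidean n E.

Structure rep (K : fieldType) (Q : quiver) := Rep {
  rspace :> vert Q -> vectType K;
  rmap : forall a : arrow Q, 'Hom(rspace (src a), rspace (tgt a)) }.

Section Representations.
Variables (K : fieldType) (Q : quiver) (V : rep K Q).

Definition is_rep_end (f : forall x : vert Q, 'End(V x)) : Prop :=
  forall a : arrow Q,
    (f (tgt a) \o rmap V a = rmap V a \o f (src a))%VF.

(* [phi] is an isomorphism of K-algebras from K onto End_Q(V); elements of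
   End_Q(V) are compared vertex by vertex. *)
Definition schur : Prop :=
  exists phi : K -> forall x : vert Q, 'End(V x),
    [/\ forall c, is_rep_end (phi c),
        forall c d, (forall x, phi c x = phi d x) -> c = d
      & forall f, is_rep_end f -> exists c, forall x, f x = phi c x] /\
    [/\ forall k c d x, phi (k * c + d) x = k *: phi c x + phi d x,
        forall c d x, phi (c * d) x = (phi c x \o phi d x)%VF
      & forall x, phi 1 x = \1%VF].

Definition is_subrep (U : forall x : vert Q, {vspace V x}) : Prop :=
  forall a : arrow Q, (rmap V a @: U (src a) <= U (tgt a))%VS.

Definition dimv (U : forall x : vert Q, {vspace V x}) : vert Q -> int :=
  fun x => (\dim (U x))%:Z.

Definition full_subrep : forall x : vert Q, {vspace V x} := fun x => fullv.

End Representations.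

Definition weight_at (Q : quiver) (theta gamma : vert Q -> int) : int :=
  \sum_(x : vert Q) theta x * gamma x.

Definition stable (K : fieldType) (Q : quiver) (theta : vert Q -> int)
    (V : rep K Q) : Prop :=
  [/\ exists x : vert Q, \dim {: V x} != 0%N,
      weight_at theta (dimv (full_subrep V)) = 0
    & forall U : (forall x : vert Q, {vspace V x}), is_subrep U ->
        (exists x, U x != 0%VS) -> (exists x, U x != fullv) ->
        weight_at theta (dimv U) < 0].

(* Main.v *)
Require Import Defs.
From HB Require Import structures.
From mathcomp Require Import all_boot all_order all_algebra zify ring.

Set Implicit Arguments.
Unset Strict Implicit.
Unset Printing Implicit Defensive.

(**
A representation V with a subrepresentation U such that 2 dim U = dim V is not
stable for any weight, since theta (dim V) = 0 forces theta (dim U) = 0.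

A connected acyclic wild quiver has three parallel arrows, or it contains a
Euclidean diagram and an arrow a0 joining a vertex of that diagram to a vertex w
outside of it.  On a Euclidean diagram of any orientation there are four bricks
R_0, ..., R_3 with the same dimension vector and no nonzero morphisms between
different ones.  Let V be their sum, with K^2 at w, and let a0 pair the i-th
summand with a vector r_i of K^2, where r_0, ..., r_3 span three different
lines.  An endomorphism of V is a scalar on each R_i and has every r_i as an
eigenvector, so it is a scalar.  If the r_i are well chosen, two of the R_i and a
line of K^2 form a subrepresentation of half the dimension.

For a tree, a brick is a vector space at a central vertex together with one flag
for each arm.  If level j of an arm is a subquotient of the flag of length
decreasing with j, any orientation of the arm yields the same condition: an
endomorphism respects the whole flag.
*)

(** * Subgraphs of a quiver *)

(** The dimension vector of every brick is the least positive imaginary root of its Euclidean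
    diagram, a dimension in which bricks come in one-parameter families. Its largest coefficient is
    the matrix size [n]: 1, 2, 3, 4, 6 for the types $\tilde A$, $\tilde D$, $\tilde E_6$, $\tilde
    E_7$, $\tilde E_8$. The parameter takes the values 0, 1, 2, 3, which characteristic zero keeps
    distinct.

    The numbers two and four balance two demands. A subrepresentation of half the dimension takes
    half of the bricks and half of the space at w, so both numbers are even. On the other hand,
    scalars are forced by three different eigenlines in K^2, whereas two would still allow every
    diagonal matrix. Four is the least even number that leaves room for three lines. Two of the
    vectors r_i then share a line, which is what lets a line of K^2 and two bricks form a
    subrepresentation; it creates no endomorphism, because different bricks are orthogonal.

    Vectors are rows throughout, so matrices act on the right and products are read from left to
    right. *)

Section Embed.
Variable Q : quiver.

Definition link (x y : vert Q) (a : arrow Q) : bool :=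
  (src a == x) && (tgt a == y) || (src a == y) && (tgt a == x).

Lemma linkC x y a : link x y a = link y x a.
Proof. by rewrite /link orbC. Qed.

Definition embed (nv : nat) (E : seq (nat * nat)) (X : nat -> vert Q)
    (B : nat -> arrow Q) : Prop :=
  [/\ {in [pred k | k < nv] &, injective X},
      {in [pred k | k < size E] &, injective B}
    & forall k, k < size E -> let e := nth (0, 0) E k in
        [/\ e.1 < nv, e.2 < nv & link (X e.1) (X e.2) (B k)]].

End Embed.

Lemma size_path_edges n : size (path_edges n) = n.-1.
Proof. by rewrite size_map size_iota. Qed.

Lemma nth_path_edges n k : k < n.-1 -> nth (0, 0) (path_edges n) k = (k, k.+1).
Proof. by move=> kn; rewrite (nth_map 0) ?size_iota // nth_iota. Qed.

Definition a_E m := rcons (path_edges m.+1) (m, 0).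

(** Type $\tilde D_{m+4}$, with the bound of [EuclideanD] absorbed into the index. The inner path is
    1, ..., m+1; the leaves 0 and m+4 hang at 1, the leaves m+2 and m+3 at m+1. *)
Definition d_E m := (path_edges m.+3 ++ [:: (m.+1, m.+3); (1, m.+4)]).

Lemma size_d_E m : size (d_E m) = m.+4.
Proof. by rewrite size_cat size_path_edges addn2. Qed.

Lemma nth_d_E m k : nth (0, 0) (d_E m) k =
  if k < m.+2 then (k, k.+1) else if k == m.+2 then (m.+1, m.+3)
  else if k == m.+3 then (1, m.+4) else (0, 0).
Proof.
rewrite nth_cat size_path_edges; case: ltnP => [km|mk]; first exact: nth_path_edges.
have [->|k2] := eqVneq k m.+2; first by rewrite subnn.
have [->|k3] := eqVneq k m.+3; first by rewrite subSnn.
by rewrite nth_default //=; lia.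
Qed.

Definition e6_E := (path_edges 5 ++ [:: (2, 5); (5, 6)]).

Definition e7_E := (path_edges 7 ++ [:: (3, 7)]).

Definition e8_E := (path_edges 8 ++ [:: (2, 8)]).

Definition set_fun (T : Type) (f : nat -> T) n v := fun i => if i == n then v else f i.

Definition has_embed Q nv E := exists X B, @embed Q nv E X B.

(** A tree grown leaf by leaf: edge k attaches the new vertex k+1 to an older one. *)
Definition treelike (E : seq (nat * nat)) := forall k, k < size E ->
  (nth (0, 0) E k).1 <= k /\ (nth (0, 0) E k).2 = k.+1.

Section Embeddings.
Variable Q : quiver.
Implicit Types (x y : vert Q) (a b : arrow Q) (X : nat -> vert Q) (B : nat -> arrow Q).

Lemma link_ends x y x' y' a : link x y a -> link x' y' a ->
  x = x' /\ y = y' \/ x = y' /\ y = x'.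
Proof.
by case/orP => /andP[/eqP<- /eqP<-] /orP[] /andP[/eqP-> /eqP->]; auto.
Qed.

(** If all arrows touching the image are used, the image is closed under adjacency, hence everything
    by connectedness, and the embedding is an isomorphism. In the other case [y] may lie in the
    image, so that [a] is a chord. *)
Lemma embed_exit nv E X B : connected_quiver Q -> 0 < nv -> embed nv E X B ->
  underlying_graph_is Q nv E \/
  exists a k y, [/\ k < nv, link (X k) y a & forall j, j < size E -> B j != a].
Proof.
move=> [_ conn] nv0 [Xinj Binj BE].
have [/existsP[a /existsP[k /andP[t /forallP f]]]|no] := boolP [exists a : arrow Q,
  exists k : 'I_nv, ((src a == X k) || (tgt a == X k)) &&
    [forall j : 'I_(size E), B j != a]].
  right; exists a, k; have fr j : j < size E -> B j != a by move=> js; apply: (f (Ordinal js)).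
  case/orP: t => /eqP t; [exists (tgt a) | exists (src a)]; split=> //.
    by rewrite /link t !eqxx.
  by rewrite /link t !eqxx orbT.
left.
have inB a k : k < nv -> (src a == X k) || (tgt a == X k) ->
    exists j : 'I_(size E), B j = a.
  move=> kn t; move: no; rewrite negb_exists => /forallP/(_ a).
  rewrite negb_exists => /forallP/(_ (Ordinal kn)); rewrite t /= negb_forall.
  by case/existsP => j /negPn/eqP; exists j.
have inX x : exists k : 'I_nv, X k = x.
  suff /existsP[k /eqP]: [exists k : 'I_nv, X k == x] by exists k.
  have cl : closed (@adjacent Q) [pred x | [exists k : 'I_nv, X k == x]].
    apply: intro_closed.
      by apply: sym_connect_sym => u v; apply: eq_existsb => a; rewrite orbC.
    move=> u v /existsP[a la] /existsP[k /eqP ku].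
    have [j ja] : exists j : 'I_(size E), B j = a.
      by apply: (inB a k) => //; rewrite ku; case/orP: la => /andP[p1 p2]; rewrite ?p1 ?p2 ?orbT.
    have [e1 e2] := BE j (ltn_ord j); rewrite ja => /link_ends/(_ la)[] [? ?].
      by apply/existsP; exists (Ordinal e2); apply/eqP.
    by apply/existsP; exists (Ordinal e1); apply/eqP.
  have := closed_connect cl (conn (X 0) x); rewrite !inE => <-.
  by apply/existsP; exists (Ordinal nv0).
have [f fX] : exists f : vert Q -> 'I_nv, forall x, X (f x) = x.
  exact: (@fin_all_exists _ _ (fun x (k : 'I_nv) => X k = x)).
have [g gB] : exists g : arrow Q -> 'I_(size E), forall a, B (g a) = a.
  apply: (@fin_all_exists _ _ (fun a (j : 'I_(size E)) => B j = a)) => a.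
  by apply: (inB a (f (src a))); rewrite ?fX ?eqxx.
have fK k : k < nv -> val (f (X k)) = k.
  by move=> kn; apply: Xinj; rewrite ?inE ?fX /=.
exists f, g; split.
- by exists (fun k : 'I_nv => X k) => // k; apply/val_inj/fK.
- exists (fun j : 'I_(size E) => B j) => // j; apply/val_inj/Binj; by rewrite ?inE ?gB /=.
move=> a; have [e1 e2] := BE _ (ltn_ord (g a)); rewrite gB.
case/orP => /andP[/eqP-> /eqP->]; rewrite !fK //; [left | right]; exact: surjective_pairing.
Qed.

Lemma embed_ext nv E X B k y a : embed nv E X B -> k < nv -> link (X k) y a ->
    (forall j, j < size E -> B j != a) -> (forall j, j < nv -> X j != y) ->
  embed nv.+1 (rcons E (k, nv)) (set_fun X nv y) (set_fun B (size E) a).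
Proof.
move=> [Xinj Binj BE] kn lk Ba Xy; rewrite /set_fun; split.
- move=> i j; rewrite !inE !ltnS => iv jv.
  case: eqP => [->|/eqP ni]; case: eqP => [->//|/eqP nj].
  + by move=> yX; move: (Xy j); rewrite yX eqxx => /(_ _) => H; have := H ltac:(lia).
  + by move=> yX; move: (Xy i); rewrite yX eqxx => H; have := H ltac:(lia).
  + by apply: Xinj; rewrite inE; lia.
- move=> i j; rewrite !inE !size_rcons !ltnS => iv jv.
  case: eqP => [->|/eqP ni]; case: eqP => [->//|/eqP nj].
  + by move=> yX; move: (Ba j); rewrite yX eqxx => H; have := H ltac:(lia).
  + by move=> yX; move: (Ba i); rewrite yX eqxx => H; have := H ltac:(lia).
  + by apply: Binj; rewrite inE; lia.
move=> j; rewrite size_rcons ltnS nth_rcons => js.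
have [->|jn] := eqVneq j (size E).
  by rewrite ltnn /= ltnS (ltnW kn) ltnSn !eqxx (ltn_eqF kn).
have {}js : j < size E by lia.
rewrite js /=; have [e1 e2 l] := BE j js.
by split; rewrite ?ltnS 1?ltnW // !ltn_eqF.
Qed.

(** A map of vertices suffices: [g] picks the first matching edge of [E]. It is injective because an
    edge of a treelike list is determined by its unordered pair of ends, the larger end being k+1
    for edge k. *)
Lemma embed_sub nv E X B E' (f : nat -> nat) : embed nv E X B -> treelike E' ->
    {in [pred k | k < (size E').+1] &, injective f} ->
    (forall k, k < (size E').+1 -> f k < nv) ->
    (forall e, e \in E' -> ((f e.1, f e.2) \in E) || ((f e.2, f e.1) \in E)) ->
  has_embed Q (size E').+1 E'.
Proof.
move=> [Xinj Binj BE] tE' finj fnv fE.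
pose t k := let e := nth (0, 0) E' k in
  [pred d | (d == (f e.1, f e.2)) || (d == (f e.2, f e.1))].
pose g k := find (t k) E.
have gE k : k < size E' -> g k < size E /\ t k (nth (0, 0) E (g k)).
  move=> ks; have ht : has (t k) E.
    by apply/hasP; case/orP: (fE _ (mem_nth (0, 0) ks)) => i;
      [exists (f (nth (0, 0) E' k).1, f (nth (0, 0) E' k).2)
      |exists (f (nth (0, 0) E' k).2, f (nth (0, 0) E' k).1)]; rewrite //= eqxx ?orbT.
  by rewrite -has_find; split=> //; apply: nth_find.
exists (X \o f), (B \o g); split.
- move=> i j ik jk /= /Xinj e; apply: finj => //; apply: e; rewrite inE; exact: fnv.
- move=> i j; rewrite !inE /= => ik jk e.
  have [gi ti] := gE i ik; have [gj tj] := gE j jk.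
  have {}e : g i = g j by apply: Binj.
  have [i1 i2] := tE' i ik; have [j1 j2] := tE' j jk.
  move: ti tj; rewrite /t /= e i2 j2.
  have F u v : u <= size E' -> v <= size E' -> f u = f v -> u = v.
    by move=> us vs; apply: finj; rewrite inE ltnS.
  case/orP => /eqP->; case/orP; rewrite xpair_eqE => /andP[/eqP/F e1 /eqP/F e2]; lia.
move=> k ks; have [gk] := gE k ks; have [k1 k2] := tE' k ks.
have [e1 e2 l] := BE _ gk.
have [f1 f2] : f (nth (0, 0) E' k).1 < nv /\ f (nth (0, 0) E' k).2 < nv.
  by split; apply: fnv; lia.
split=> /=; try lia.
by case/orP: b => /eqP ek; move: l; rewrite ek //= linkC.
Qed.

(* No arrow a joins two vertices connected by [avoid a] iff there are no cycles. *)
Definition avoid a : rel (vert Q) := fun x y => [exists b, (b != a) && link x y b].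

Lemma avoid_sym a : connect_sym (avoid a).
Proof.
by apply: sym_connect_sym => x y; apply: eq_existsb => b; rewrite linkC.
Qed.

(** A simple path that avoids [a], closed up by [a], is a cycle. It has at least two vertices since
    [a] is not a loop, and exactly two if it consists of an arrow with the same ends as [a]. *)
Lemma cycle_embed a : src a != tgt a -> connect (avoid a) (src a) (tgt a) ->
  exists2 m, 0 < m & has_embed Q m.+1 (a_E m).
Proof.
move=> st /connectP[p0 pp0 tq].
have [p [pp up tp0]] : exists p,
    [/\ path (avoid a) (src a) p, uniq (src a :: p) & tgt a = last (src a) p].
  by rewrite tq; case/shortenP: pp0 => p pp up _; exists p.
exists (size p); first by case: p tp0 {pp up} => //= ts; rewrite ts eqxx in st.
pose X := nth (src a) (src a :: p).
have Xinj i j : i <= size p -> j <= size p -> X i = X j -> i = j.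
  by move=> ip jp /eqP; rewrite /X nth_uniq //= => /eqP.
pose B k := if k < size p then odflt a [pick b | (b != a) && link (X k) (X k.+1) b] else a.
have BP k : k < size p -> B k != a /\ link (X k) (X k.+1) (B k).
  move=> kp; rewrite /B kp; case: pickP => [b /andP[]//|].
  have /existsP[b bP] := pathP (src a) pp k kp.
  by move/(_ b); rewrite bP.
have Bm : B (size p) = a by rewrite /B ltnn.
exists X, B; rewrite /a_E; split.
- by move=> i j; rewrite !inE !ltnS; apply: Xinj.
- move=> i j; rewrite !inE size_rcons size_path_edges /= !ltnS => ip jp.
  have [->|ni] := eqVneq i (size p); have [->//|nj] := eqVneq j (size p).
  + by rewrite Bm => e; have [] := BP j ltac:(lia); rewrite -e eqxx.
  + by rewrite Bm => e; have [] := BP i ltac:(lia); rewrite e eqxx.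
  have {ni}ip : i < size p by lia.
  have {nj}jp : j < size p by lia.
  move=> e; have [_ li] := BP i ip; have [_ lj] := BP j jp.
  rewrite e in li; case: (link_ends li lj) => -[e1 e2].
    by apply: (Xinj i j) => //; lia.
  have := Xinj i j.+1 ltac:(lia) ltac:(lia) e1.
  have := Xinj i.+1 j ltac:(lia) ltac:(lia) e2.
  lia.
move=> k; rewrite size_rcons size_path_edges /= ltnS nth_rcons size_path_edges /= => kp.
have [->|nk] := eqVneq k (size p).
  have Xm : X (size p) = tgt a.
    by rewrite tp0; apply: (nth_last (src a) (src a :: p)).
  by rewrite ltnn /= ltnSn Bm Xm /link /X /= !eqxx orbT.
have {nk}kp : k < size p by lia.
by rewrite kp nth_path_edges //=; have [_ l] := BP k kp; split=> //; lia.
Qed.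

(** The embedded tree connects all its vertices without using [a], so an end [y] inside it would
    make [a] close a cycle. *)
Lemma tree_fresh E X B a k y :
    (forall a, ~~ connect (avoid a) (src a) (tgt a)) ->
    embed (size E).+1 E X B -> treelike E -> k < (size E).+1 -> link (X k) y a ->
    (forall j, j < size E -> B j != a) ->
  forall j, j < (size E).+1 -> X j != y.
Proof.
move=> tree [Xinj Binj BE] tE kE lk Ba j jE; apply/eqP => jy.
have c0 i : i < (size E).+1 -> connect (avoid a) (X 0) (X i).
  elim/ltn_ind: i => -[|i] IH iE //.
  have iE' : i < size E by lia.
  have [t1 t2] := tE i iE'; have [_ _ /=] := BE i iE'; rewrite t2 => l.
  apply: (connect_trans (IH (nth (0, 0) E i).1 _ _) (connect1 _)); try lia.
  by apply/existsP; exists (B i); rewrite Ba.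
have cxy u v : u < (size E).+1 -> v < (size E).+1 -> connect (avoid a) (X u) (X v).
  by move=> uE vE; apply: connect_trans (c0 v vE); rewrite avoid_sym c0.
by move: (tree a); rewrite -jy in lk; case/orP: lk => /andP[/eqP-> /eqP->]; rewrite cxy.
Qed.

End Embeddings.

(** * Euclidean trees inside wild trees *)

Inductive euclidean_tree : nat -> seq (nat * nat) -> Prop :=
| ETreeD m : euclidean_tree m.+4.+1 (d_E m)
| ETree6 : euclidean_tree 7 e6_E
| ETree7 : euclidean_tree 8 e7_E
| ETree8 : euclidean_tree 9 e8_E.

Lemma euclidean_treeE nv E : euclidean_tree nv E -> euclidean nv E.
Proof.
case=> [m|||]; [exact: (@EuclideanD m.+4) | exact: EuclideanE6
  | exact: EuclideanE7 | exact: EuclideanE8].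
Qed.

Lemma treelike_path n : treelike (path_edges n).
Proof. by move=> k; rewrite size_path_edges => kn; rewrite nth_path_edges. Qed.

Lemma treelike_rcons E k n : treelike E -> n = (size E).+1 -> k < n ->
  treelike (rcons E (k, n)).
Proof.
move=> tE -> kE j; rewrite size_rcons ltnS nth_rcons => jE.
by have [->|nj] := eqVneq j (size E); rewrite ?ltnn // ltn_neqAle nj jE; apply: tE; lia.
Qed.

Lemma treelike_rcons2 n k l : k < n.+1 -> l < n.+2 ->
  treelike (rcons (rcons (path_edges n.+1) (k, n.+1)) (l, n.+2)).
Proof.
move=> kn ln; do 2?apply: treelike_rcons; rewrite ?size_rcons ?size_path_edges //.
exact: treelike_path.
Qed.

Lemma d_E_rcons m :
  d_E m = rcons (rcons (path_edges m.+3) (m.+1, m.+3)) (1, m.+4).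
Proof. by rewrite -!cats1 -catA. Qed.

Lemma euclidean_tree_treelike nv E : euclidean_tree nv E ->
  treelike E /\ nv = (size E).+1.
Proof.
case=> [m|||]; split=> //.
- by rewrite d_E_rcons; apply: treelike_rcons2.
- by rewrite size_d_E.
- exact: (@treelike_rcons2 4 2 5).
- by case=> [|[|[|[|[|[|[|]]]]]]].
- by case=> [|[|[|[|[|[|[|[|]]]]]]]].
Qed.

Lemma mem_path_edges n e :
  (e \in path_edges n) = (e.1 < n.-1) && (e.2 == e.1.+1).
Proof.
apply/mapP/andP => [[i]|[e1 /eqP e2]]; first by rewrite mem_iota => /andP[_ ?] ->.
by exists e.1; rewrite ?mem_iota // -e2 -surjective_pairing.
Qed.

Section Trees.
Variable Q : quiver.
Hypothesis connQ : connected_quiver Q.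
Hypothesis wildQ : wild Q.
Hypothesis treeQ : forall a : arrow Q, ~~ connect (avoid a) (src a) (tgt a).

Definition has_etree := exists nv E, euclidean_tree nv E /\ has_embed Q nv E.

Lemma tree_step E : has_embed Q (size E).+1 E -> treelike E ->
  underlying_graph_is Q (size E).+1 E \/
  exists k, k <= size E /\ has_embed Q (size E).+2 (rcons E (k, (size E).+1)).
Proof.
move=> [X [B XB]] tE; have [U|[a [k [y [kE l fr]]]]] := embed_exit connQ (ltn0Sn _) XB.
  by left.
right; exists k; split=> //; eexists; eexists; apply: (embed_ext XB kE l fr).
exact: (tree_fresh treeQ XB tE kE l fr).
Qed.

Lemma has_embed_sub nv E E' (f : nat -> nat) : has_embed Q nv E -> treelike E' ->
    {in [pred k | k < (size E').+1] &, injective f} ->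
    (forall k, k < (size E').+1 -> f k < nv) ->
    (forall e, e \in E' -> ((f e.1, f e.2) \in E) || ((f e.2, f e.1) \in E)) ->
  has_embed Q (size E').+1 E'.
Proof. by move=> [X [B XB]]; apply: embed_sub XB. Qed.

Definition has_path m := has_embed Q m.+1 (path_edges m.+1).
Definition branch_edges m k := rcons (path_edges m.+1) (k, m.+1).

Lemma has_path_bound m : has_path m -> m < #|vert Q|.
Proof.
case=> X [B [Xinj _ _]].
have inj : injective (fun i : 'I_m.+1 => X i).
  by move=> i j /Xinj e; apply: val_inj; apply: e; rewrite inE.
by have := leq_card _ inj; rewrite card_ord.
Qed.

Lemma size_branch_edges m k : size (branch_edges m k) = m.+1.
Proof. by rewrite size_rcons size_path_edges. Qed.

Lemma treelike_branch m k : k <= m -> treelike (branch_edges m k).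
Proof.
move=> km; apply: treelike_rcons; rewrite ?size_path_edges //.
exact: treelike_path.
Qed.

Lemma mem_branch_edges m k e : (e \in branch_edges m k) = (e == (k, m.+1)) || (e.1 < m) && (e.2 == e.1.+1).
Proof. by rewrite mem_rcons inE mem_path_edges. Qed.

Lemma has_path_sub m nv E (f : nat -> nat) : has_embed Q nv E ->
    {in [pred k | k <= m] &, injective f} -> (forall k, k <= m -> f k < nv) ->
    (forall k, k < m -> ((f k, f k.+1) \in E) || ((f k.+1, f k) \in E)) ->
  has_path m.
Proof.
move=> e finj fnv fE; have := @has_embed_sub nv E (path_edges m.+1) f e (@treelike_path _).
rewrite size_path_edges; apply=> //.
by move=> [i j]; rewrite mem_path_edges /= => /andP[im /eqP->]; apply: fE.
Qed.

Lemma branch_flip m k : k <= m -> has_embed Q m.+2 (branch_edges m k) -> has_embed Q m.+2 (branch_edges m (m - k)).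
Proof.
move=> km e; pose f i := if i == m.+1 then m.+1 else m - i.
have := @has_embed_sub _ _ (branch_edges m (m - k)) f e (treelike_branch (leq_subr k m)); rewrite size_branch_edges; apply.
- by move=> i j; rewrite !inE /f; do !case: ifP; lia.
- by move=> i; rewrite /f; do !case: ifP; lia.
- move=> [i j]; rewrite !mem_branch_edges /f /= !xpair_eqE.
  by do !case: ifP; lia.
Qed.

(** The segment from k+1 to k+d+1 is the inner path of a $\tilde D_{d+4}$: its leaves are [x], [y]
    and the neighbours k and k+d+2 on the path. For d = 0 this is the star with four leaves. *)
Lemma path_fork_etree nv E m k d x y : has_embed Q nv E ->
    (forall i, i < m -> (i, i.+1) \in E) -> (k.+1, x) \in E -> (k + d.+1, y) \in E ->
    k + d.+1 < m -> m < x < nv -> m < y < nv -> x != y ->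
  has_etree.
Proof.
move=> e path ix iy dm /andP[mx xn] /andP[my yn] xy.
exists d.+4.+1, (d_E d); split; first exact: ETreeD.
have [tD sD] := euclidean_tree_treelike (ETreeD d); rewrite sD.
pose f i := if i < d.+3 then k + i else if i == d.+3 then y else x.
have fl i : i < d.+3 -> f i = k + i by rewrite /f => ->.
have fy : f d.+3 = y by rewrite /f ltnn eqxx.
have fx : f d.+4 = x by rewrite /f ltnNge leqnSn /= gtn_eqF.
have km i : i < d.+3 -> k + i <= m.
  by move=> il; apply: leq_trans dm; rewrite -addnS leq_add2l.
have cases i : i < d.+4.+1 -> [\/ i < d.+3, i = d.+3 | i = d.+4].
  rewrite ltnS leq_eqVlt => /orP[/eqP|]; first by constructor 3.
  by rewrite ltnS leq_eqVlt => /orP[/eqP|]; [constructor 2 | constructor 1].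
apply: (has_embed_sub (f := f)) e tD _ _ _; rewrite -?sD.
- have ne i z : m < z -> i < d.+3 -> k + i <> z.
    by move=> mz /km km' kz; rewrite kz leqNgt mz in km'.
  move=> i j; rewrite !inE => /cases[il|->|->] /cases[jl|->|->];
    rewrite ?fx ?fy ?fl // => eij.
  + exact: addnI eij.
  + by case: (ne i y).
  + by case: (ne i x).
  + by case: (ne j y).
  + by rewrite eij eqxx in xy.
  + by case: (ne j x).
  + by rewrite eij eqxx in xy.
- have mn := ltn_trans mx xn.
  by move=> i /cases[il|->|->]; rewrite ?fx ?fy // fl // (leq_ltn_trans (km i il)).
move=> [i j]; rewrite d_E_rcons mem_rcons inE mem_rcons inE mem_path_edges !xpair_eqE.
case/or3P => /andP[/= i1 /eqP->].
- by rewrite (eqP i1) fx fl // addn1 ix.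
- by rewrite (eqP i1) fy fl // iy.
by rewrite !fl // 1?ltnW // addnS path // -addnS km.
Qed.

Section Step.
Variable m : nat.
Hypothesis IH : forall m', m < m' -> has_path m' -> has_etree.

(** The position [l] of the new vertex decides. At an end of the path, the path grows. At the branch
    vertex m+1, either a longer path runs through the branch (k = 1 or k = m-1), or all three arms
    at [k] have length at least two and contain $\tilde E_6$. At an inner vertex of the path there
    are two forks, hence some $\tilde D$. *)
Lemma branch_exit k l : 0 < k < m -> l < m.+2 ->
  has_embed Q m.+3 (rcons (branch_edges m k) (l, m.+2)) -> has_etree.
Proof.
move=> km lm e.
have memE i j : ((i, j) \in rcons (branch_edges m k) (l, m.+2)) =
    [|| (i == l) && (j == m.+2), (i == k) && (j == m.+1) | (i < m) && (j == i.+1)].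
  by rewrite mem_rcons inE mem_branch_edges !xpair_eqE.
have inP i : i < m -> (i, i.+1) \in rcons (branch_edges m k) (l, m.+2).
  by move=> im; rewrite memE im eqxx !orbT.
have [inK inL] : (k, m.+1) \in rcons (branch_edges m k) (l, m.+2) /\
    (l, m.+2) \in rcons (branch_edges m k) (l, m.+2) by rewrite !memE !eqxx orbT.
have [lE|lm'] := eqVneq l m.
  apply: (IH (ltnSn m)); apply: (has_path_sub (f := fun i => if i == m.+1 then m.+2 else i)) e _ _ _.
  - by move=> i j; rewrite !inE /=; do !case: ifP; lia.
  - by move=> i /=; do !case: ifP; lia.
  - by move=> i im; rewrite !memE /=; do !case: ifP; lia.
have [l0|l0] := eqVneq l 0.
  rewrite l0 in e inP inL.
  apply: (IH (ltnSn m)); apply: (has_path_sub (f := fun i => if i == 0 then m.+2 else i.-1)) e _ _ _.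
  - by move=> i j; rewrite !inE /=; do !case: ifP; lia.
  - by move=> i /=; do !case: ifP; lia.
  - by case=> [|i] im /=; rewrite ?inL ?orbT // inP.
have [l1|l1] := eqVneq l m.+1.
  rewrite l1 in e memE inP inK inL.
  have [k1|k1] := eqVneq k 1.
    rewrite k1 in e inP inK inL.
    apply: (IH (ltnSn m)); apply: (has_path_sub (f := fun i => if i == 0 then m.+2 else
      if i == 1 then m.+1 else i.-1)) e _ _ _.
    - by move=> i j; rewrite !inE /=; do !case: ifP; lia.
    - by move=> i /=; do !case: ifP; lia.
    - by case=> [|[|i]] im /=; rewrite ?inK ?inL ?orbT // inP.
  have [k2|k2] := eqVneq k m.-1.
    apply: (IH (ltnSn m)); apply: (has_path_sub (f := fun i => if i == m then m.+1 else
      if i == m.+1 then m.+2 else i)) e _ _ _.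
    - by move=> i j; rewrite !inE /=; do !case: ifP; lia.
    - by move=> i /=; do !case: ifP; lia.
    - by move=> i im; rewrite !memE /=; do !case: ifP; lia.
  exists 7, e6_E; split; first exact: ETree6.
  have [k0 k0E] : exists k0, k = k0.+2 by exists k.-2; lia.
  have k0m : k0.+3 < m by lia.
  rewrite k0E in e inP inK inL; clear -e inP inK inL k0m.
  apply: (@has_embed_sub _ _ e6_E (nth 0 [:: k0; k0.+1; k0.+2; k0.+3; k0.+4; m.+1; m.+2]) e) => /=.
  - by have [] := euclidean_tree_treelike ETree6.
  - by case=> [|[|[|[|[|[|[|//]]]]]]] [|[|[|[|[|[|[|//]]]]]]]; rewrite /= => _ _; lia.
  - by case=> [|[|[|[|[|[|[|//]]]]]]] /= _; lia.
  - by apply/allP; rewrite /= inK inL !inP //; lia.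
have [k0 k0E] : exists k0, k = k0.+1 by exists k.-1; lia.
have [l' l0E] : exists l', l = l'.+1 by exists l.-1; lia.
have [kl|lk] := leqP k l.
  apply: (@path_fork_etree _ _ m k0 (l - k) m.+1 m.+2 e inP); rewrite -?l0E -?k0E //; try lia.
  by rewrite (_ : k0 + _ = l) //; lia.
apply: (@path_fork_etree _ _ m l' (k - l) m.+2 m.+1 e inP); rewrite -?l0E -?k0E //; try lia.
by rewrite (_ : l' + _ = k) //; lia.
Qed.

Lemma branch_step k : 0 < k < m -> has_embed Q m.+2 (branch_edges m k) ->
  underlying_graph_is Q m.+2 (branch_edges m k) \/ has_etree.
Proof.
move=> km e; have kYm : k <= m by lia.
have := tree_step (E := branch_edges m k); rewrite size_branch_edges => /(_ e (treelike_branch kYm)) [U|[l [lm e']]].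
  by left.
by right; apply: branch_exit km _ e'.
Qed.

(** The tree is $D_{m+2}$; wildness forbids that it is the whole quiver, so it extends. *)
Lemma branch_at_1 k : k = m.-1 -> 1 < m -> has_embed Q m.+2 (branch_edges m k) -> has_etree.
Proof.
move=> -> m1 /branch_step[|U|//]; first by lia.
have [nd _] := wildQ U; case: nd; rewrite (_ : m.-1 = m.+2 - 3); last by lia.
by apply: (@DynkinD m.+2); lia.
Qed.

(** The arms at the branching vertex have lengths 2, m-2 and 1. This is $E_6$, $E_7$, $E_8$ for m =
    4, 5, 6, excluded by wildness, and contains $\tilde E_8$ from m = 7 on. *)
Lemma branch_at_2 k : k = 2 -> 3 < m -> has_embed Q m.+2 (branch_edges m k) -> has_etree.
Proof.
move=> -> m3 e; have [m7|m7] := leqP 7 m.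
  exists 9, e8_E; split; first exact: ETree8.
  apply: (@has_embed_sub _ _ e8_E (fun i => if i == 8 then m.+1 else i) e) => /=.
  - by have [] := euclidean_tree_treelike ETree8.
  - by move=> i j; rewrite !inE /=; do !case: ifP; lia.
  - by move=> i /=; do !case: ifP; lia.
  - by apply/allP; rewrite /= !mem_branch_edges /= !xpair_eqE; lia.
have [|U|//] := branch_step _ e; first by lia.
by have [nd _] := wildQ U; case: nd; apply: (@DynkinE m.+2); lia.
Qed.

Lemma branch_etree k : 0 < k < m -> has_embed Q m.+2 (branch_edges m k) -> has_etree.
Proof.
move=> km e; have e' : has_embed Q m.+2 (branch_edges m (m - k)) by apply: branch_flip e; lia.
have [k1|k1] := eqVneq k m.-1; first by apply: branch_at_1 k1 _ e; lia.
have [k2|k2] := eqVneq k 1; first by apply: branch_at_1 _ _ e'; lia.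
have [k3|k3] := eqVneq k 2; first by apply: branch_at_2 k3 _ e; lia.
have [k4|k4] := eqVneq (m - k) 2; first by apply: branch_at_2 k4 _ e'; lia.
(* Both arms along the path now have length at least 3, so the star with arms 3, 3, 1 fits, with its
   centre at k'+3. *)
exists 8, e7_E; split; first exact: ETree7.
have [k' k'E] : exists k', k = k'.+3 by exists (k - 3); lia.
have k'm : k'.+4.+2 <= m by lia.
have inP i : i < m -> (i, i.+1) \in branch_edges m k.
  by move=> im; rewrite mem_branch_edges /= im eqxx orbT.
have inK : (k, m.+1) \in branch_edges m k by rewrite mem_branch_edges eqxx.
rewrite k'E in e inP inK; clear -e inP inK k'm.
apply: (@has_embed_sub _ _ e7_E (fun i => if i == 7 then m.+1 else k' + i) e) => /=.
- by have [] := euclidean_tree_treelike ETree7.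
- by move=> i j; rewrite !inE /=; do !case: ifP; lia.
- by move=> i /=; do !case: ifP; lia.
- by apply/allP; rewrite /= !addnS addn0 inK !inP //; lia.
Qed.

Lemma has_path_step : has_path m -> has_etree.
Proof.
move=> e; have := tree_step (E := path_edges m.+1).
rewrite size_path_edges => /(_ e (@treelike_path _)) [U|[k [km e']]].
  by have [nd _] := wildQ U; case: nd; apply: DynkinA.
have memE i j : ((i, j) \in rcons (path_edges m.+1) (k, m.+1)) =
    (i == k) && (j == m.+1) || (i < m) && (j == i.+1).
  by rewrite mem_branch_edges xpair_eqE.
have [lE|lm'] := eqVneq k m.
  apply: (IH (ltnSn m)); apply: (has_path_sub (f := id)) e' _ _ _ => //.
  by move=> i im; rewrite !memE /=; lia.
have [l0|l0] := eqVneq k 0.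
  apply: (IH (ltnSn m)); apply: (has_path_sub (f := fun i => if i == 0 then m.+1 else i.-1)) e' _ _ _.
  - by move=> i j; rewrite !inE /=; do !case: ifP; lia.
  - by move=> i /=; do !case: ifP; lia.
  - by move=> i im; rewrite !memE /=; do !case: ifP; lia.
by apply: branch_etree e'; lia.
Qed.
End Step.

(* A longer path is handled by induction, so that m is in effect the length of a
   longest path. *)
Lemma tree_main m : has_path m -> has_etree.
Proof.
have [d] := ubnP (#|vert Q| - m); elim: d => // d IH in m *; rewrite ltnS => dm pm.
apply: has_path_step pm => m' mm' pm'; apply: (IH _ _ pm').
by have := has_path_bound pm'; lia.
Qed.

Lemma tree_has_etree : has_etree.
Proof.
have [x0 _] : exists x : vert Q, x \in predT by apply/card_gt0P; case: connQ.
(* An embedding carries a total function into the arrows even when it has no edges, so a quiver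
   without arrows is treated apart: it is $A_1$. *)
have [/existsP[a0 _]|noa] := boolP [exists a : arrow Q, true].
  apply: (tree_main (m := 0)); exists (fun=> x0), (fun=> a0); split=> //.
  by move=> [|i] [|j].
have na (a : arrow Q) : False by move: noa; rewrite negb_exists => /forallP/(_ a).
have allx x : x = x0.
  have /connectP[[|y p] /=] := connQ.2 x0 x; first by [].
  by case/andP => /existsP[a]; case: (na a).
pose g (a : arrow Q) : 'I_(size (path_edges 1)) := False_rect _ (na a).
have [nd _] : ~ dynkin 1 (path_edges 1) /\ ~ euclidean 1 (path_edges 1).
  apply: wildQ; exists (fun=> ord0), g; split.
  - by exists (fun=> x0) => [x|i]; [rewrite [RHS]allx | rewrite [RHS]ord1].
  - by exists (fun i : 'I_0 => let: Ordinal _ h := i in False_rect _ (notF h)) => [a|[]//];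
      case: (na a).
  - by move=> a; case: (na a).
by case: nd; apply: DynkinA.
Qed.

End Trees.

Import Order.TTheory GRing.Theory Num.Theory.
Local Open Scope ring_scope.

(** * Representations given by idempotents *)

(* The involution s exchanges the image of q with a complement. *)
Lemma half_dim (K : fieldType) (E : vectType K) (q s : 'End(E)) :
    (forall v, q (q v) = q v) -> (forall v, s (s v) = v) ->
    (forall v, s (q v) = s v - q (s v)) ->
  \dim {: E} = (\dim (limg q)).*2.
Proof.
move=> qq ss sq.
have full : (fullv = limg q + s @: limg q)%VS.
  apply/eqP; rewrite eqEsubv subvf andbT; apply/subvP => v _.
  apply/memv_addP; exists (q v); first by rewrite memv_img ?memvf.
  exists (s (q (s v))); first by rewrite !memv_img ?memvf.
  by rewrite sq ss addrC subrK.
have disj : (limg q :&: s @: limg q = 0)%VS.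
  apply/eqP; rewrite -subv0; apply/subvP => v.
  case/memv_capP => /memv_imgP[u _ ->] /memv_imgP[_ /memv_imgP[w _ ->]].
  by rewrite sq => /(congr1 q); rewrite qq linearB /= qq subrr => ->; rewrite mem0v.
have inj : (limg q :&: lker s = 0)%VS.
  apply/eqP; rewrite -subv0; apply/subvP => v.
  rewrite memv_cap memv_ker => /andP[_ /eqP sv].
  by rewrite -[v]ss sv linear0 mem0v.
by rewrite [in LHS]full (dimv_disjoint_sum disj) (limg_dim_eq inj) addnn.
Qed.

Section Realize.
Variables (K : fieldType) (Q : quiver) (E : vectType K).
Variables (p : vert Q -> 'End(E)) (m : arrow Q -> 'End(E)) (q s : 'End(E)).
Hypothesis p_idem : forall x v, p x (p x v) = p x v.
Hypothesis p_m : forall a v, p (tgt a) (m a v) = m a v.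
Hypothesis m_p : forall a v, m a (p (src a) v) = m a v.

(* The space at x is the image of an idempotent p x of a common space E, so that
   morphisms become families of endomorphisms of E. *)
Definition mspace (x : vert Q) : vectType K := subvs_of (limg (p x)).

Lemma p_fix x v : v \in limg (p x) -> p x v = v.
Proof. by case/memv_imgP => u _ ->; rewrite p_idem. Qed.

Lemma p_in x v : p x v \in limg (p x).
Proof. by apply: memv_img; rewrite memvf. Qed.

Definition mincl (x : vert Q) : 'Hom(mspace x, E) := linfun (@vsval _ _ (limg (p x))).
Definition mproj (x : vert Q) : 'Hom(E, mspace x) := linfun (@vsproj _ _ (limg (p x))).

Lemma minclE x (v : mspace x) : mincl x v = vsval v.
Proof. by rewrite lfunE. Qed.
Lemma mprojE x v : mproj x v = vsproj (limg (p x)) v.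
Proof. by rewrite lfunE. Qed.
Lemma minclK x (v : mspace x) : mproj x (mincl x v) = v.
Proof. by rewrite minclE mprojE vsvalK. Qed.
Lemma mprojK x v : mincl x (mproj x (p x v)) = p x v.
Proof. by rewrite minclE mprojE vsprojK // p_in. Qed.
Lemma p_mincl x (v : mspace x) : p x (mincl x v) = mincl x v.
Proof. by apply: p_fix; rewrite minclE subvsP. Qed.

Definition mrep : rep K Q :=
  @Rep K Q mspace (fun a => (mproj (tgt a) \o m a \o mincl (src a))%VF).

Lemma mincl_mrep a (v : mspace (src a)) :
  mincl (tgt a) (rmap mrep a v) = m a (mincl (src a) v).
Proof. by rewrite /= !comp_lfunE /= -[m a _]p_m mprojK p_m. Qed.

Hypothesis p_nz : exists x, p x != 0.
Hypothesis m_schur : forall H : vert Q -> 'End(E),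
  (forall x v, H x (p x v) = H x v) -> (forall x v, p x (H x v) = H x v) ->
  (forall a v, H (tgt a) (m a v) = m a (H (src a) v)) ->
  exists c, forall x v, H x v = c *: p x v.

(** The image of [q] is the future subrepresentation, and [s] exchanges it with a complement.
    Accordingly [q_m] asks only for a stable image: a [q] commuting with the arrows would be a
    nonscalar endomorphism. *)
Hypothesis q_idem : forall v, q (q v) = q v.
Hypothesis s_inv : forall v, s (s v) = v.
Hypothesis s_q : forall v, s (q v) = s v - q (s v).
Hypothesis q_p : forall x v, q (p x v) = p x (q v).
Hypothesis s_p : forall x v, s (p x v) = p x (s v).
Hypothesis q_m : forall a v, m a (q v) = q (m a (q v)).

Lemma mspace_nz : exists x (v : mspace x), v != 0.
Proof.
have [x px] := p_nz; have [v pv] : exists v, p x v != 0.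
  have [/subvP p0|/subvPn[v _ pv]] := boolP (fullv <= lker (p x))%VS.
    case/eqP: px; apply/lfunP => v; rewrite lfunE /=; apply/eqP.
    by rewrite -memv_ker p0 ?memvf.
  by exists v; rewrite -memv_ker.
exists x, (mproj x (p x v)); apply: contraNneq pv => /(congr1 (mincl x)).
by rewrite mprojK linear0 => ->.
Qed.

Lemma mrep_schur : schur mrep.
Proof.
exists (fun c x => c *: \1%VF); split; split.
- by move=> c a; rewrite -comp_lfunZl -comp_lfunZr comp_lfun1l comp_lfun1r.
- move=> c d cd; have [x [v v0]] := mspace_nz.
  move/lfunP/(_ v): (cd x); rewrite !scale_lfunE !id_lfunE => /eqP.
  by rewrite -subr_eq0 -scalerBl scaler_eq0 (negPf v0) orbF subr_eq0 => /eqP.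
(* Each component of [f] is extended by zero along [p x] to an endomorphism of [E], the kind of map
   that [m_schur] speaks about. *)
- move=> f f_end; pose H x := (mincl x \o f x \o mproj x \o p x)%VF.
  have HE x (v : mspace x) : H x (mincl x v) = mincl x (f x v).
    by rewrite !comp_lfunE /= p_mincl minclK.
  have HP x v : H x (p x v) = H x v by rewrite !comp_lfunE /= p_idem.
  have HI x v : H x v = H x (mincl x (mproj x (p x v))) by rewrite mprojK HP.
  have [//|x v|a v|c Hc] := @m_schur H.
  + by rewrite HI HE p_mincl.
  + rewrite -m_p -mprojK -mincl_mrep HE [in RHS]HI HE -mincl_mrep; congr (mincl _ _).
    by move/lfunP/(_ (mproj (src a) (p (src a) v))): (f_end a); rewrite !comp_lfunE.
  + exists c => x; apply/lfunP => v; apply: (can_inj (@minclK x)).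
    by rewrite -HE Hc p_mincl scale_lfunE id_lfunE linearZ.
- by move=> k c d x; rewrite scalerA scalerDl.
- by move=> c d x; rewrite -comp_lfunZl -comp_lfunZr comp_lfun1l scalerA.
- by move=> x; rewrite scale1r.
Qed.

(** As [q] and [s] commute with each [p x], they restrict to every vertex, and [half_dim] applies
    there. At a vertex with nonzero space, half of the space is both nonzero and proper. *)
Lemma mrep_unstable theta : ~ stable theta mrep.
Proof.
case=> _ th0 thneg.
pose c x : 'End(mspace x) := (mproj x \o q \o mincl x)%VF.
pose t x : 'End(mspace x) := (mproj x \o s \o mincl x)%VF.
have cE x v : mincl x (c x v) = q (mincl x v).
  by rewrite !comp_lfunE /= -[mincl x v]p_mincl q_p mprojK.
have tE x v : mincl x (t x v) = s (mincl x v).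
  by rewrite !comp_lfunE /= -[mincl x v]p_mincl s_p mprojK.
have mincl_inj x := can_inj (@minclK x).
have dimc x : (\dim {: mspace x} = (\dim (limg (c x))).*2)%N.
  apply: half_dim (t x) _ _ _ => v; apply: mincl_inj.
  - by rewrite !cE q_idem.
  - by rewrite !tE s_inv.
  - by rewrite linearB /= tE !cE tE s_q.
pose U x : {vspace mrep x} := limg (c x).
have wU : weight_at theta (Defs.dimv U) = 0.
  move: th0; rewrite /weight_at /Defs.dimv /full_subrep.
  under eq_bigr => x _ do rewrite dimc -addnn PoszD mulrDr.
  by rewrite big_split /= -mulr2n => /eqP; rewrite mulrn_eq0 => /eqP.
have [x [v v0]] := mspace_nz.
have dx : (0 < \dim {: mspace x})%N.
  rewrite lt0n dimv_eq0; apply: contraNneq v0 => x0.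
  by rewrite -memv0 -x0 memvf.
suff: weight_at theta (Defs.dimv U) < 0 by rewrite wU ltxx.
apply: thneg.
- move=> a; apply/subvP => _ /memv_imgP[_ /memv_imgP[u _ ->] ->].
  apply/memv_imgP; exists (rmap mrep a (c (src a) u)); first exact: memvf.
  by apply: mincl_inj; rewrite cE !mincl_mrep cE q_m.
- by exists x; rewrite -dimv_eq0; move: dx; rewrite dimc; case: (\dim _).
- exists x; apply/eqP => Ux.
  have dU : \dim (limg (c x)) = \dim {: mspace x} := congr1 (fun W => \dim W) Ux.
  move: dx (dimc x); rewrite dU; case: (\dim _) => // n _ /eqP.
  by rewrite -addnn -[X in X == _]addn0 eqn_add2l.
Qed.

End Realize.

(** * Gluing four orthogonal bricks along an arrow *)

Lemma mulmx_lin1 (K : fieldType) m n (f : 'rV[K]_m -> 'rV[K]_n) :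
  linear f -> forall v, v *m lin1_mx f = f v.
Proof.
move=> lf v.
pose L : {linear 'rV[K]_m -> 'rV[K]_n} :=
  HB.pack f (GRing.isLinear.Build _ _ _ _ f lf).
exact: (mul_rV_lin1 L).
Qed.

Lemma mulmx_ext (K : fieldType) m n (A B : 'M[K]_(m, n)) :
  (forall v : 'rV_m, v *m A = v *m B) -> A = B.
Proof. by move=> AB; apply/row_matrixP => i; rewrite !rowE. Qed.

Lemma mulcr_inj (K : fieldType) m n (x : 'rV[K]_n) (c d : 'cV[K]_m) :
  x != 0 -> c *m x = d *m x -> c = d.
Proof.
case/rV0Pn => k xk /matrixP cd; apply/matrixP => i j; rewrite ord1.
have := cd i k; rewrite !mxE !big_ord1 => /eqP.
by rewrite -subr_eq0 -mulrBl mulf_eq0 (negPf xk) orbF subr_eq0 => /eqP.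
Qed.

Lemma sum_ord2 (V : nmodType) (F : 'I_2 -> V) : \sum_i F i = F 0 + F 1.
Proof. by rewrite big_ord_recl big_ord1; congr (_ + F _); apply: val_inj. Qed.

Lemma mulrc_inj (K : fieldType) m n (x : 'cV[K]_n) (c d : 'rV[K]_m) :
  x != 0 -> x *m c = x *m d -> c = d.
Proof.
rewrite -trmx_eq0 => x0 /(congr1 trmx); rewrite !trmx_mul => /(mulcr_inj x0).
exact: trmx_inj.
Qed.

Lemma mx2_scalar (K : fieldType) (W : 'M[K]_2) (c : 'I_4 -> K) d :
    W 0 0 = d -> W 0 1 = 0 -> W 1 0 = 0 -> W 1 1 = d ->
    c 0 = d -> c 1 = d -> c 2 = d -> c 3 = d ->
  exists d, W = d%:M /\ forall i, c i = d.
Proof.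
move=> W00 W01 W10 W11 c0 c1 c2 c3; exists d; split.
  apply/matrixP => -[[|[|//]] i] [[|[|//]] j]; rewrite mxE /= ?mulr0n ?mulr1n.
  - by rewrite -W00; congr (W _ _); apply: val_inj.
  - by rewrite -W01; congr (W _ _); apply: val_inj.
  - by rewrite -W10; congr (W _ _); apply: val_inj.
  - by rewrite -W11; congr (W _ _); apply: val_inj.
case=> -[|[|[|[|//]]]] i.
- by rewrite -[RHS]c0; congr (c _); apply: val_inj.
- by rewrite -[RHS]c1; congr (c _); apply: val_inj.
- by rewrite -[RHS]c2; congr (c _); apply: val_inj.
- by rewrite -[RHS]c3; congr (c _); apply: val_inj.
Qed.

Definition swap2 (K : nzRingType) : 'M[K]_2 := delta_mx 0 1 + delta_mx 1 0.

Lemma swap2_inv (K : nzRingType) : swap2 K *m swap2 K = 1%:M.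
Proof.
rewrite mulmxDl !mulmxDr !mul_delta_mx_cond /= !mulr0n !mulr1n add0r addr0.
apply/matrixP => i j; rewrite !mxE.
by case: i j => [[|[|//]] ?] [[|[|//]] ?] /=; rewrite ?addr0 ?add0r.
Qed.

Lemma swap2_delta (K : nzRingType) :
  delta_mx 1 1 *m swap2 K = swap2 K - swap2 K *m delta_mx 1 1.
Proof.
rewrite mulmxDr mulmxDl !mul_delta_mx_cond /= !mulr0n !mulr1n !add0r !addr0.
by rewrite /swap2 [delta_mx 0 1 + _]addrC addrK.
Qed.

Section Block.
Variables (K : fieldType) (n : nat).
Definition ambient : vectType K := ({ffun 'I_4 -> 'rV[K]_n} * 'rV[K]_2)%type.

Variables (f : 'I_4 -> 'I_4) (T : 'I_4 -> 'M[K]_n) (R : 'I_4 -> 'M[K]_(2, n)).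
Variables (S : 'I_4 -> 'M[K]_(n, 2)) (c : 'M[K]_2).

(** A 5 by 5 block matrix of restricted shape: [T] acts on the summands after the relabelling [f],
    [R] leads from K^2 to them, [S] leads back, and [c] acts on K^2. *)
Definition block_fun (u : ambient) : ambient :=
  ([ffun i => u.1 (f i) *m T i + u.2 *m R i], \sum_i u.1 i *m S i + u.2 *m c).

Lemma block_fun_linear : linear block_fun.
Proof.
move=> k [A t] [B s]; congr (_, _) => /=.
  by apply/ffunP => i; rewrite !ffunE !mulmxDl -!scalemxAl scalerDr addrACA.
rewrite mulmxDl -scalemxAl scalerDr addrACA scaler_sumr -big_split /=.
by congr (_ + _); apply: eq_bigr => i _; rewrite !ffunE mulmxDl -scalemxAl.
Qed.
HB.instance Definition _ := GRing.isLinear.Build K ambient ambient _ block_fun block_fun_linear.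

Definition block_end : 'End(ambient) := linfun block_fun.
Lemma block_endE u : block_end u = block_fun u. Proof. by rewrite lfunE. Qed.
End Block.

Section Glue.
Variables (K : fieldType) (Q : quiver) (n : nat).
Variables (P : vert Q -> 'M[K]_n) (M : 'I_4 -> arrow Q -> 'M[K]_n).
Variables (w : vert Q) (a0 : arrow Q) (x0 : 'rV[K]_n) (xi : 'cV[K]_n).
Hypothesis P_idem : forall x, P x *m P x = P x.
Hypothesis P_M : forall i a, P (src a) *m M i a = M i a.
Hypothesis M_P : forall i a, M i a *m P (tgt a) = M i a.
Hypothesis P_w : P w = 0.
Hypothesis orth : forall i j (h : vert Q -> 'M[K]_n),
  (forall x, P x *m h x *m P x = h x) ->
  (forall a, M i a *m h (tgt a) = h (src a) *m M j a) ->
  if i == j then exists c, forall x, h x = c *: P x else forall x, h x = 0.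

(* out_col takes the values e_0, e_0, e_1, e_0 + e_1 and in_row the values e_0,
   e_0 + e_1, e_1, e_1; gq projects onto the last two summands plus e_1, and this
   is a subrepresentation for either direction of a0. *)
Definition out_col (i : 'I_4) : 'cV[K]_2 :=
  \col_(k < 2) (if k == 0 :> nat then i != 2 :> nat else (2 <= i)%N)%:R.
Definition in_row (i : 'I_4) : 'rV[K]_2 :=
  \row_(k < 2) (if k == 0 :> nat then (i <= 1)%N else i != 0 :> nat)%:R.

Definition gP x : 'End(ambient K n) :=
  block_end id (fun=> P x) (fun=> 0) (fun=> 0) ((x == w)%:R%:M).
(** Rank-one maps for [a0]: out of [w], a row t goes to (t [out_col i]) [x0]; into [w], a row v goes
    to (v [xi]) [in_row i]. Since [a0] is not a loop, only one of the two directions occurs. *)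
Definition gR a i : 'M_(2, n) :=
  if (a == a0) && (src a == w) then out_col i *m x0 else 0.
Definition gS a i : 'M_(n, 2) :=
  if (a == a0) && (tgt a == w) then xi *m in_row i else 0.
Definition gM a : 'End(ambient K n) :=
  block_end id (fun i => M i a) (gR a) (gS a) 0.
Definition gq : 'End(ambient K n) :=
  block_end id (fun i => (2 <= i)%N%:R%:M) (fun=> 0) (fun=> 0) (delta_mx 1 1).
(** Index reversal exchanges the bricks 2, 3 with 1, 0, and [swap2] exchanges e_1 with e_0. It
    commutes with [gP] because the four bricks share the same spaces. *)
Definition gs : 'End(ambient K n) :=
  block_end (@rev_ord 4) (fun=> 1%:M) (fun=> 0) (fun=> 0) (swap2 K).

Hypothesis a0_loop : src a0 != tgt a0.
Hypothesis x0_nz : x0 != 0.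
Hypothesis xi_nz : xi != 0.
Hypothesis a0_w : (src a0 == w) && (x0 *m P (tgt a0) == x0) ||
  (tgt a0 == w) && (P (src a0) *m xi == xi).

Lemma gR_P a i : gR a i *m P (tgt a) = gR a i.
Proof.
rewrite /gR; case: eqP => [->|_]; last by rewrite mul0mx.
case: eqP => [s0|_]; last by rewrite mul0mx.
case/orP: a0_w => /andP[/eqP aw /eqP xP]; first by rewrite -mulmxA xP.
by move: a0_loop; rewrite s0 aw eqxx.
Qed.

Lemma gS_P a i : P (src a) *m gS a i = gS a i.
Proof.
rewrite /gS; case: eqP => [->|_]; last by rewrite mulmx0.
case: eqP => [s0|_]; last by rewrite mulmx0.
case/orP: a0_w => /andP[/eqP aw /eqP xP]; last by rewrite mulmxA xP.
by move: a0_loop; rewrite s0 aw eqxx.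
Qed.

Lemma gR_w a i : (src a == w)%:R *: gR a i = gR a i.
Proof. by rewrite /gR; case: (src a == w); rewrite ?andbF (scale1r, scaler0). Qed.
Lemma gS_w a i : (tgt a == w)%:R *: gS a i = gS a i.
Proof. by rewrite /gS; case: (tgt a == w); rewrite ?andbF (scale1r, scaler0). Qed.

Lemma M_w i a : (src a == w) || (tgt a == w) -> M i a = 0.
Proof.
case/orP => /eqP aw; first by rewrite -P_M aw P_w mul0mx.
by rewrite -M_P aw P_w mulmx0.
Qed.

Lemma gPE x u : gP x u = ([ffun i => u.1 i *m P x], (x == w)%:R *: u.2).
Proof.
rewrite block_endE /block_fun; congr (_, _) => /=.
  by apply/ffunP => i; rewrite !ffunE mulmx0 addr0.
by rewrite big1 => [|i _]; rewrite ?mulmx0 // add0r mul_mx_scalar.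
Qed.

Lemma gME a u : gM a u =
  ([ffun i => u.1 i *m M i a + u.2 *m gR a i], \sum_i u.1 i *m gS a i).
Proof. by rewrite block_endE /block_fun mulmx0 addr0. Qed.

Lemma gqE u : gq u = ([ffun i : 'I_4 => (2 <= i)%N%:R *: u.1 i], u.2 *m delta_mx 1 1).
Proof.
rewrite block_endE /block_fun; congr (_, _) => /=.
  by apply/ffunP => i; rewrite !ffunE mulmx0 addr0 mul_mx_scalar.
by rewrite big1 => [|i _]; rewrite ?mulmx0 // add0r.
Qed.

Lemma gsE u : gs u = ([ffun i => u.1 (rev_ord i)],
  u.2 *m swap2 K).
Proof.
rewrite block_endE /block_fun; congr (_, _) => /=.
  by apply/ffunP => i; rewrite !ffunE mulmx0 addr0 mulmx1.
by rewrite big1 => [|i _]; rewrite ?mulmx0 // add0r.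
Qed.

Lemma gP_idem x u : gP x (gP x u) = gP x u.
Proof.
rewrite !gPE /=; congr (_, _); last by case: eqP; rewrite !(scale0r, scale1r).
by apply/ffunP => i; rewrite !ffunE -mulmxA P_idem.
Qed.

Lemma gP_gM a u : gP (tgt a) (gM a u) = gM a u.
Proof.
rewrite gPE gME /=; congr (_, _).
  by apply/ffunP => i; rewrite !ffunE mulmxDl -!mulmxA M_P gR_P.
by rewrite scaler_sumr; apply: eq_bigr => i _; rewrite scalemxAr gS_w.
Qed.

Lemma gM_gP a u : gM a (gP (src a) u) = gM a u.
Proof.
rewrite !gME gPE /=; congr (_, _).
  by apply/ffunP => i; rewrite !ffunE -!mulmxA P_M -scalemxAl scalemxAr gR_w.
by apply: eq_bigr => i _; rewrite ffunE -mulmxA gS_P.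
Qed.

Lemma gq_idem u : gq (gq u) = gq u.
Proof.
rewrite !gqE /=; congr (_, _); last by rewrite -mulmxA mul_delta_mx.
by apply/ffunP => i; rewrite !ffunE; case: leqP; rewrite !(scale0r, scale1r).
Qed.

Lemma gs_inv u : gs (gs u) = u.
Proof.
case: u => A t; rewrite !gsE /=; congr (_, _).
  by apply/ffunP => i; rewrite !ffunE rev_ordK.
by rewrite -mulmxA swap2_inv mulmx1.
Qed.

Lemma gs_gq u : gs (gq u) = gs u - gq (gs u).
Proof.
rewrite gsE gqE gqE gsE /=; congr (_, _) => /=.
  apply/ffunP => i; rewrite !ffunE /=.
  by case: i => [[|[|[|[|//]]]] ?] /=; rewrite ?(scale0r, scale1r, subr0, subrr).
by rewrite -!mulmxA -mulmxBr swap2_delta.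
Qed.

Lemma gq_gP x u : gq (gP x u) = gP x (gq u).
Proof.
rewrite !gqE !gPE /=; congr (_, _); last by rewrite scalemxAl.
by apply/ffunP => i; rewrite !ffunE scalemxAl.
Qed.

Lemma gs_gP x u : gs (gP x u) = gP x (gs u).
Proof.
rewrite !gsE !gPE /=; congr (_, _); last by rewrite scalemxAl.
by apply/ffunP => i; rewrite !ffunE.
Qed.

Lemma gq_gM a u : gM a (gq u) = gq (gM a (gq u)).
Proof.
rewrite !gME !gqE /=; congr (_, _).
  apply/ffunP => i; rewrite !ffunE; case: (leqP 2 i) => [_|i2]; first by rewrite /= !scale1r.
  rewrite !scale0r mul0mx add0r /gR; case: ifP => _; last by rewrite mulmx0.
  (* The columns 0 and 1 equal e_0 and kill the line of e_1, so nothing leaks into the first two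
     bricks. *)
  rewrite -!mulmxA (mulmxA (delta_mx _ _)) (_ : _ *m out_col i = 0) ?mul0mx ?mulmx0 //.
  apply/colP => k; rewrite !mxE big_ord_recl big_ord1 !mxE /= leqNgt i2.
  by rewrite mulr0 andbF mul0r addr0.
rewrite mulmx_suml; apply: eq_bigr => i _; rewrite !ffunE -mulmxA.
case: (leqP 2 i) => [i2|_]; last by rewrite !scale0r !mul0mx.
congr (_ *m _); rewrite /gS; case: ifP => _; last by rewrite mul0mx.
rewrite -mulmxA; congr (_ *m _); apply/rowP => k.
rewrite !mxE big_ord_recl big_ord1 !mxE /= leqNgt (leq_trans _ i2) //= mul0r add0r.
by case: k => [[|[|//]] ?] /=; rewrite ?mulr0 ?mulr1 //= leqNgt (leq_trans _ i2).
Qed.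

Section Schur.
Variable H : vert Q -> 'End(ambient K n).
Hypothesis H_gP : forall x u, H x (gP x u) = H x u.
Hypothesis gP_H : forall x u, gP x (H x u) = H x u.
Hypothesis H_gM : forall a u, H (tgt a) (gM a u) = gM a (H (src a) u).

Definition ginj i (v : 'rV[K]_n) : ambient K n := ([ffun k => if k == i then v else 0], 0).
Definition ginj2 (t : 'rV[K]_2) : ambient K n := ([ffun=> 0], t).

Lemma ginj_linear i : linear (ginj i).
Proof.
move=> k u v; congr (_, _); last by rewrite /= scaler0 addr0.
by apply/ffunP => j; rewrite !ffunE; case: eqP; rewrite ?scaler0 ?addr0.
Qed.

Lemma ginj2_linear : linear ginj2.
Proof.
by move=> k u v; congr (_, _); apply/ffunP => j; rewrite !ffunE scaler0 addr0.
Qed.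

Lemma ambient_decomp (u : ambient K n) : u = \sum_i ginj i (u.1 i) + ginj2 u.2.
Proof.
case: u => A t.
have fst_sum (F : 'I_4 -> ambient K n) : (\sum_i F i).1 = \sum_i (F i).1.
  by elim/big_rec2: _ => // i y1 y2 _ <-.
have snd_sum (F : 'I_4 -> ambient K n) : (\sum_i F i).2 = \sum_i (F i).2.
  by elim/big_rec2: _ => // i y1 y2 _ <-.
congr (_, _); rewrite /= ?fst_sum ?snd_sum /=; last by rewrite big1 ?add0r.
apply/ffunP => j; rewrite !ffunE addr0 sum_ffunE (bigD1 j) //= ffunE eqxx.
by rewrite big1 ?addr0 // => i ij; rewrite ffunE eq_sym (negPf ij).
Qed.

Definition hom_comp i j x : 'M[K]_n := lin1_mx (fun v => (H x (ginj i v)).1 j).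

Lemma hom_compE i j x v : v *m hom_comp i j x = (H x (ginj i v)).1 j.
Proof.
rewrite mulmx_lin1 // => k u t.
by rewrite ginj_linear linearP /= !ffunE.
Qed.

Lemma gP_ginj x i v : gP x (ginj i v) = ginj i (v *m P x).
Proof.
rewrite gPE /ginj scaler0; congr (_, _); apply/ffunP => j; rewrite !ffunE.
by case: eqP; rewrite ?mul0mx.
Qed.

Lemma gM_ginj a i v :
  gM a (ginj i v) = ginj i (v *m M i a) + ginj2 (v *m gS a i).
Proof.
rewrite gME /= [RHS]/GRing.add /=; congr (_, _).
  apply/ffunP => j; rewrite !ffunE mul0mx !addr0.
  by case: eqP => [->|]; rewrite ?mul0mx.
rewrite add0r (bigD1 i) //= ffunE eqxx big1 ?addr0 // => j ji.
by rewrite ffunE (negPf ji) mul0mx.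
Qed.

Lemma hom_comp_P i j x : P x *m hom_comp i j x *m P x = hom_comp i j x.
Proof.
apply: mulmx_ext => v; rewrite !mulmxA !hom_compE -gP_ginj H_gP -[in RHS]gP_H gPE.
by rewrite ffunE.
Qed.

(** Off [a0] the blocks of [H] see only the maps of the bricks. At [a0] both sides vanish, since
    this arrow meets [w], where [P] is zero. *)
Lemma hom_comp_M i j a : M i a *m hom_comp i j (tgt a) = hom_comp i j (src a) *m M j a.
Proof.
have [->|aa0] := eqVneq a a0.
  by rewrite !M_w ?mul0mx ?mulmx0 //; case/orP: a0_w => /andP[-> _]; rewrite ?orbT.
apply: mulmx_ext => v; rewrite !mulmxA !hom_compE.
have := congr1 (fun u : ambient K n => u.1 j) (H_gM a (ginj i v)).
rewrite gM_ginj /gS (negPf aa0) mulmx0 (_ : ginj2 0 = 0) ?addr0; last first.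
  by congr (_, _); apply/ffunP => k; rewrite !ffunE.
by move=> ->; rewrite gME ffunE /gR (negPf aa0) mulmx0 addr0.
Qed.

Definition wcomp : 'M[K]_2 := lin1_mx (fun t => (H w (ginj2 t)).2).

Lemma wcompE t : t *m wcomp = (H w (ginj2 t)).2.
Proof. by rewrite mulmx_lin1 // => k u v; rewrite ginj2_linear linearP. Qed.

Lemma H_ginj2 x t j : (H x (ginj2 t)).1 j = 0.
Proof.
have [->|xw] := eqVneq x w; first by rewrite -gP_H gPE ffunE P_w mulmx0.
rewrite -H_gP (_ : gP x _ = 0) ?linear0 ?ffunE //.
rewrite gPE (negPf xw) scale0r; congr (_, _).
by apply/ffunP => k; rewrite !ffunE mul0mx.
Qed.

Lemma H_fst x u j : (H x u).1 j = \sum_i u.1 i *m hom_comp i j x.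
Proof.
rewrite [u in LHS]ambient_decomp linearD linear_sum /= ffunE H_ginj2 addr0.
under [RHS]eq_bigr do rewrite hom_compE.
by apply: (big_morph (fun z : ambient K n => z.1 j)) => [z1 z2|]; rewrite /= ffunE.
Qed.

Lemma H_snd u : (H w u).2 = u.2 *m wcomp.
Proof.
rewrite wcompE -H_gP gPE eqxx scale1r; congr (H w (_, _)).2.
by apply/ffunP => k; rewrite !ffunE P_w mulmx0.
Qed.

Lemma H_scalar : exists c, forall x u, H x u = c *: gP x u.
Proof.
have [c Hc] : exists c : 'I_4 -> K, forall i x, hom_comp i i x = c i *: P x.
  apply: (@fin_all_exists _ _ (fun i c => forall x, hom_comp i i x = c *: P x)) => i.
  by have := orth (hom_comp_P i i) (hom_comp_M i i); rewrite eqxx.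
have H0 i j x : i != j -> hom_comp i j x = 0.
  by move=> ij; have := orth (hom_comp_P i j) (hom_comp_M i j); rewrite (negPf ij).
have HF x u j : (H x u).1 j = c j *: (u.1 j *m P x).
  rewrite H_fst (bigD1 j) //= Hc -scalemxAr big1 ?addr0 // => i ij.
  by rewrite H0 ?mulmx0.
suff [d [wd cd]] : exists d, wcomp = d%:M /\ forall i, c i = d.
  exists d => x u; rewrite [LHS]surjective_pairing gPE; congr (_, _) => /=.
    by apply/ffunP => j; rewrite HF cd !ffunE.
  have [->|xw] := eqVneq x w; first by rewrite H_snd wd mul_mx_scalar scale1r.
  by rewrite -gP_H gPE (negPf xw) !scale0r scaler0.
case/orP: a0_w => /andP[/eqP aw /eqP xP].
  have ev i : c i *: out_col i = wcomp *m out_col i.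
    apply: (mulcr_inj x0_nz); apply: mulmx_ext => t.
    have gRi : gR a0 i = out_col i *m x0 by rewrite /gR aw !eqxx.
    have := congr1 (fun u : ambient K n => u.1 i) (H_gM a0 (ginj2 t)).
    rewrite HF !gME !ffunE mul0mx add0r -mulmxA gR_P gRi H_ginj2 mul0mx add0r aw H_snd /=.
    by rewrite -!mulmxA -scalemxAl -scalemxAr.
  have e i k : wcomp k 0 * out_col i 0 0 + wcomp k 1 * out_col i 1 0 = c i * out_col i k 0.
    by move/matrixP/(_ k 0): (ev i); rewrite [LHS]mxE [RHS]mxE sum_ord2.
  move: (wcomp) e => W e.
  (* The eigenvectors e_0 and e_1 (indices 0 and 2) make [W] diagonal, and e_0 + e_1 (index 3)
     equates its diagonal entries. *)
  move: (e 0 0) (e 0 1) (e 1 0) (e 2 0) (e 2 1) (e 3 0) (e 3 1).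
  rewrite !mxE /= !mulr1 !mulr0 !addr0 !add0r => e0 W10 e1 W01 e2.
  rewrite W10 W01 add0r addr0 => e3 e4.
  by apply: (@mx2_scalar _ _ _ (c 3)); rewrite -?e0 -?e1 -?e2.
have ev i : in_row i *m wcomp = c i *: in_row i.
  apply: (mulrc_inj xi_nz); apply: mulmx_ext => v.
  have gSi : gS a0 i = xi *m in_row i by rewrite /gS aw !eqxx.
  have := congr1 (fun u : ambient K n => u.2) (H_gM a0 (ginj i v)).
  rewrite aw H_snd !gME /= (bigD1 i) //= big1 => [|k ki]; last first.
    by rewrite ffunE (negPf ki) mul0mx.
  rewrite ffunE eqxx addr0 (mulmxA xi) -gSi mulmxA => ->.
  rewrite (bigD1 i) //= big1 => [|k ki]; last first.
    by rewrite HF ffunE (negPf ki) mul0mx scaler0 mul0mx.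
  by rewrite HF ffunE eqxx addr0 -scalemxAl -mulmxA gS_P gSi -!scalemxAr.
have e i k : in_row i 0 0 * wcomp 0 k + in_row i 0 1 * wcomp 1 k = c i * in_row i 0 k.
  by move/matrixP/(_ 0 k): (ev i); rewrite [LHS]mxE [RHS]mxE sum_ord2.
move: (wcomp) e => W e.
(* The same three eigenvectors, but now e_0 + e_1 has index 1. *)
move: (e 0 0) (e 0 1) (e 1 0) (e 1 1) (e 2 0) (e 2 1) (e 3 1).
rewrite !mxE /= !mul1r !mul0r !mulr1 !mulr0 !addr0 !add0r => e0 W01 + + W10 e2 e3.
rewrite W10 W01 add0r addr0 => e1 e4.
by apply: (@mx2_scalar _ _ _ (c 1)); rewrite -?e0 -?e2 -?e3.
Qed.

End Schur.

Lemma gP_nz : exists x, gP x != 0.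
Proof.
exists w; apply/eqP => /lfunP/(_ (ginj2 (const_mx 1))).
rewrite gPE eqxx scale1r lfunE /= => /(congr1 (fun u : ambient K n => u.2 0 0)).
by rewrite !mxE => /eqP; rewrite oner_eq0.
Qed.

Lemma glue_rep : exists V : rep K Q,
  schur V /\ forall theta : vert Q -> int, ~ stable theta V.
Proof.
exists (mrep gP gM); split=> [|theta].
  apply: mrep_schur gP_idem gP_gM gM_gP gP_nz H_scalar.
exact: (@mrep_unstable _ _ _ gP gM gq gs gP_idem gP_gM gP_nz
  gq_idem gs_inv gs_gq gq_gP gs_gP gq_gM).
Qed.

End Glue.

Definition esrc (o : nat -> bool) (E : seq (nat * nat)) k :=
  let e := nth (0, 0)%N E k in if o k then e.1 else e.2.
Definition etgt (o : nat -> bool) (E : seq (nat * nat)) k :=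
  let e := nth (0, 0)%N E k in if o k then e.2 else e.1.

(* Here o k means that the arrow on edge k points from its first to its second end;
   P gives the spaces and L i the maps of the i-th representation. *)
Definition brickfam (K : fieldType) (nv : nat) (E : seq (nat * nat)) : Prop :=
  forall o : nat -> bool, exists n (P : nat -> 'M[K]_n) (L : 'I_4 -> nat -> 'M[K]_n),
  [/\ forall k, (k < nv)%N -> P k *m P k = P k /\ P k != 0,
      forall i k, (k < size E)%N ->
        P (esrc o E k) *m L i k = L i k /\ L i k *m P (etgt o E k) = L i k
    & forall i j (h : nat -> 'M[K]_n),
        (forall k, (k < nv)%N -> P k *m h k *m P k = h k) ->
        (forall k, (k < size E)%N ->
          L i k *m h (etgt o E k) = h (esrc o E k) *m L j k) ->
        if i == j then exists c, forall k, (k < nv)%N -> h k = c *: P k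
        else forall k, (k < nv)%N -> h k = 0].

Lemma idem_fix_row (K : fieldType) n (P : 'M[K]_n) :
  P *m P = P -> P != 0 -> exists2 x : 'rV_n, x != 0 & x *m P = x.
Proof.
move=> PP /matrix0Pn[i [j Pij]]; exists (row i P); last by rewrite -row_mul PP.
by apply: contraNneq Pij => /rowP/(_ j); rewrite !mxE => ->.
Qed.

Lemma idem_fix_col (K : fieldType) n (P : 'M[K]_n) :
  P *m P = P -> P != 0 -> exists2 x : 'cV_n, x != 0 & P *m x = x.
Proof.
move=> PP /matrix0Pn[i [j Pij]]; exists (col j P); last by rewrite colE mulmxA PP.
by apply: contraNneq Pij => /colP/(_ i); rewrite !mxE => ->.
Qed.

(** Extension by zero: [PP] and [MM] vanish off the embedded diagram, so further arrows of [Q], even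
    between its vertices, impose no condition. The vector [x0] and the functional [xi] at [X k0]
    exist because [P k0] is nonzero. *)
Lemma embed_rep (K : fieldType) (Q : quiver) nv E (X : nat -> vert Q) B w k0 a0 :
    brickfam K nv E -> embed nv E X B -> (k0 < nv)%N ->
    (forall k, (k < nv)%N -> X k != w) -> link (X k0) w a0 ->
  exists V : rep K Q, schur V /\ forall theta : vert Q -> int, ~ stable theta V.
Proof.
move=> fam [Xinj Binj BE] k0nv Xw a0w.
pose o k := src (B k) == X (nth (0, 0)%N E k).1.
have ends k : (k < size E)%N ->
    [/\ src (B k) = X (esrc o E k), tgt (B k) = X (etgt o E k),
        (esrc o E k < nv)%N & (etgt o E k < nv)%N].
  move=> kE; have [e1 e2] := BE k kE; rewrite /link /esrc /etgt /o.
  case: eqP => [-> | _] /=; last by move=> /andP[/eqP-> /eqP->].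
  by case/orP => [/eqP->|/andP[/eqP-> /eqP->]].
have [n [P [L [Pid LP orth]]]] := fam o.
pose PP x : 'M[K]_n := if [pick k : 'I_nv | X k == x] is Some k then P k else 0.
have PPX k : (k < nv)%N -> PP (X k) = P k.
  move=> knv; rewrite /PP; case: pickP => [l /eqP/Xinj->//|/(_ (Ordinal knv))].
    by rewrite inE.
  by rewrite /= eqxx.
have PPcase x : (exists2 k, (k < nv)%N & x = X k) \/ PP x = 0.
  by rewrite /PP; case: pickP => [k /eqP <-|_]; [left; exists k | right].
pose MM i a : 'M[K]_n :=
  if [pick k : 'I_(size E) | B k == a] is Some k then L i k else 0.
have MMB i k : (k < size E)%N -> MM i (B k) = L i k.
  move=> knv; rewrite /MM; case: pickP => [l /eqP/Binj->//|/(_ (Ordinal knv))].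
    by rewrite inE.
  by rewrite /= eqxx.
have MMcase a : (exists2 k, (k < size E)%N & a = B k) \/ forall i, MM i a = 0.
  by rewrite /MM; case: pickP => [k /eqP <-|_]; [left; exists k | right].
have PPid x : PP x *m PP x = PP x.
  by case: (PPcase x) => [[k kn ->]|->]; rewrite ?mulmx0 // PPX //; case: (Pid k kn).
have PM i a : PP (src a) *m MM i a = MM i a.
  case: (MMcase a) => [[k kE ->]|->]; last by rewrite mulmx0.
  by have [-> _ ? _] := ends k kE; rewrite PPX // MMB //; case: (LP i k kE).
have MP i a : MM i a *m PP (tgt a) = MM i a.
  case: (MMcase a) => [[k kE ->]|->]; last by rewrite mul0mx.
  by have [_ -> _ ?] := ends k kE; rewrite PPX // MMB //; case: (LP i k kE).
have PPw : PP w = 0.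
  by case: (PPcase w) => // -[k kn wk]; case/eqP: (Xw k kn).
have [Pk0 Pk0nz] := Pid k0 k0nv.
have [x0 x0nz x0P] := idem_fix_row Pk0 Pk0nz.
have [xi xinz xiP] := idem_fix_col Pk0 Pk0nz.
apply: (@glue_rep K Q n PP MM w a0 x0 xi) => //.
- move=> i j h hP hM.
  have hPX k : (k < nv)%N -> P k *m h (X k) *m P k = h (X k).
    by move=> kn; rewrite -PPX ?hP.
  have hL k : (k < size E)%N ->
      L i k *m h (X (etgt o E k)) = h (X (esrc o E k)) *m L j k.
    by move=> kE; have [<- <- _ _] := ends k kE; rewrite -!MMB.
  have := orth i j (h \o X) hPX hL; case: eqP => _.
    case=> c hc; exists c => x; case: (PPcase x) => [[k kn ->]|x0'].
      by rewrite PPX // -hc.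
    by rewrite -hP x0' mul0mx mul0mx scaler0.
  move=> h0 x; case: (PPcase x) => [[k kn ->]|x0']; first exact: h0.
  by rewrite -hP x0' !mul0mx.
- case/orP: a0w => /andP[/eqP-> /eqP->]; first exact: Xw.
  by rewrite eq_sym Xw.
- case/orP: a0w => /andP[/eqP-> /eqP->]; rewrite PPX // eqxx ?x0P ?xiP ?eqxx //.
  by rewrite orbT.
Qed.

(** * Three parallel arrows *)

Section ThreeArrows.
Variables (K : fieldType) (Q : quiver) (u w : vert Q) (b1 b2 b3 : arrow Q).
Hypothesis b_uniq : uniq [:: b1; b2; b3].
Hypothesis src_b : forall b, b \in [:: b1; b2; b3] -> src b = u.
Hypothesis tgt_b : forall b, b \in [:: b1; b2; b3] -> tgt b = w.

(** Dimension 2 at both ends. The arrow [b1] identifies the two planes; the matrices on [b2] and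
    [b3] have only scalars in their common commutant, yet both preserve the line of e_1, which is
    half of each plane. *)
Definition kmx (b : arrow Q) : 'M[K]_2 :=
  if b == b1 then 1%:M else if b == b2 then delta_mx 1 1
  else if b == b3 then delta_mx 0 1 else 0.
Definition kP (x : vert Q) : 'End('rV[K]_2) := ((x == u) || (x == w))%:R *: \1%VF.
Definition kM b : 'End('rV[K]_2) := linfun (mulmxr (kmx b)).
Definition kq : 'End('rV[K]_2) := linfun (mulmxr (delta_mx 1 1)).
Definition ks : 'End('rV[K]_2) := linfun (mulmxr (swap2 K)).

Lemma kPE x v : kP x v = ((x == u) || (x == w))%:R *: v.
Proof. by rewrite scale_lfunE id_lfunE. Qed.
Lemma kME b v : kM b v = v *m kmx b. Proof. by rewrite lfunE. Qed.
Lemma kqE v : kq v = v *m delta_mx 1 1. Proof. by rewrite lfunE. Qed.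
Lemma ksE v : ks v = v *m swap2 K. Proof. by rewrite lfunE. Qed.

Lemma kmx_out b : b \notin [:: b1; b2; b3] -> kmx b = 0.
Proof. by rewrite !inE !negb_or /kmx => /and3P[/negPf-> /negPf-> /negPf->]. Qed.

Lemma kP_idem x v : kP x (kP x v) = kP x v.
Proof. by rewrite !kPE; case: (_ || _); rewrite ?(scale1r, scale0r). Qed.

Lemma kP_kM a v : kP (tgt a) (kM a v) = kM a v.
Proof.
rewrite kPE kME; have [/tgt_b->|/kmx_out->] := boolP (a \in [:: b1; b2; b3]).
  by rewrite eqxx orbT scale1r.
by rewrite mulmx0 scaler0.
Qed.

Lemma kM_kP a v : kM a (kP (src a) v) = kM a v.
Proof.
rewrite kPE !kME; have [/src_b->|/kmx_out->] := boolP (a \in [:: b1; b2; b3]).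
  by rewrite eqxx scale1r.
by rewrite !mulmx0.
Qed.

Lemma kP_nz : exists x, kP x != 0.
Proof.
exists u; apply/eqP => /lfunP/(_ (const_mx 1)).
rewrite kPE eqxx scale1r lfunE /= => /rowP/(_ 0).
by rewrite !mxE => /eqP; rewrite oner_eq0.
Qed.

Lemma kq_idem v : kq (kq v) = kq v.
Proof. by rewrite !kqE -mulmxA mul_delta_mx. Qed.

Lemma ks_inv v : ks (ks v) = v.
Proof. by rewrite !ksE -mulmxA swap2_inv mulmx1. Qed.

Lemma ks_kq v : ks (kq v) = ks v - kq (ks v).
Proof. by rewrite !ksE !kqE -!mulmxA -mulmxBr swap2_delta. Qed.

Lemma kq_kP x v : kq (kP x v) = kP x (kq v).
Proof. by rewrite !kPE linearZ. Qed.

Lemma ks_kP x v : ks (kP x v) = kP x (ks v).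
Proof. by rewrite !kPE linearZ. Qed.

Lemma kq_kM a v : kM a (kq v) = kq (kM a (kq v)).
Proof.
rewrite !kME !kqE -!mulmxA; congr (_ *m _); rewrite /kmx.
case: eqP => _; first by rewrite mulmx1 mul1mx mul_delta_mx.
case: eqP => _; first by rewrite !mul_delta_mx.
by case: eqP => _; rewrite ?mul_delta_mx // mul0mx.
Qed.

Lemma kM_schur (H : vert Q -> 'End('rV[K]_2)) :
  (forall x v, H x (kP x v) = H x v) -> (forall x v, kP x (H x v) = H x v) ->
  (forall a v, H (tgt a) (kM a v) = kM a (H (src a) v)) ->
  exists c, forall x v, H x v = c *: kP x v.
Proof.
move=> HP _ HM; pose F := lin1_mx (H u).
have HuE v : H u v = v *m F by rewrite mulmx_lin1 //; apply: linearP.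
clearbody F.
have inb : [/\ b1 \in [:: b1; b2; b3], b2 \in [:: b1; b2; b3]
    & b3 \in [:: b1; b2; b3]] by rewrite !inE !eqxx !orbT.
have [i1 i2 i3] := inb.
have HwE v : H w v = v *m F.
  by have := HM b1 v; rewrite (src_b i1) (tgt_b i1) !kME /kmx eqxx !mulmx1 HuE.
have comm b : b \in [:: b1; b2; b3] -> kmx b *m F = F *m kmx b.
  move=> ib; apply: mulmx_ext => v; rewrite !mulmxA -HwE -HuE -!kME.
  by rewrite -(tgt_b ib) -(src_b ib) HM.
have [b12 b13 b23] : [/\ b1 != b2, b1 != b3 & b2 != b3].
  by move: b_uniq; rewrite /= !inE negb_or => /andP[/andP[-> ->] /andP[-> _]].
have k2 : kmx b2 = delta_mx 1 1 by rewrite /kmx eq_sym (negPf b12) eqxx.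
have k3 : kmx b3 = delta_mx 0 1.
  by rewrite /kmx eq_sym (negPf b13) eq_sym (negPf b23) eqxx.
have := comm _ i2; rewrite k2 => /matrixP c2.
have := comm _ i3; rewrite k3 => /matrixP c3.
(* Commuting with E_11 kills the off-diagonal entries, and commuting with E_01 equates the diagonal
   ones. *)
have F10 := c2 1 0; have F01 := c2 0 1; have F11 := c3 0 1.
move: F10 F01 F11; rewrite !mxE !sum_ord2 !mxE /=.
rewrite !(mul0r, mulr0, mul1r, mulr1, add0r, addr0) => F10 F01 F11.
have [d [FE _]] : exists d, F = d%:M /\ forall i : 'I_4, F 0 0 = d.
  by apply: (@mx2_scalar K F (fun=> F 0 0) (F 0 0)).
exists d => x v; rewrite kPE.
have [->|xu] := eqVneq x u; first by rewrite HuE FE mul_mx_scalar scale1r.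
have [->|xw] := eqVneq x w; first by rewrite HwE FE mul_mx_scalar scale1r.
by rewrite -HP kPE (negPf xu) (negPf xw) !scale0r linear0 scaler0.
Qed.

Lemma three_arrows_rep : exists V : rep K Q,
  schur V /\ forall theta : vert Q -> int, ~ stable theta V.
Proof.
exists (mrep kP kM); split=> [|theta].
  exact: mrep_schur kP_idem kP_kM kM_kP kP_nz kM_schur.
exact: (@mrep_unstable _ _ _ kP kM kq ks kP_idem kP_kM kP_nz
  kq_idem ks_inv ks_kq kq_kP ks_kP kq_kM).
Qed.

End ThreeArrows.

(** * Orthogonal bricks on Euclidean diagrams *)

Lemma scalar_mx0 (K : nzRingType) n : 0%:M = 0 :> 'M[K]_n.
Proof. exact: raddf0. Qed.

Section Arm.
Variables (K : fieldType) (n : nat) (blk : 'I_n -> nat) (ds : seq bool).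

(* A bit of ds is true if the arrow points away from the centre.  The space at level
   j is spanned by the basis vectors whose position in the flag, blk, lies in
   [alo j, ahi j): an outward arrow kills the lowest position and an inward arrow
   misses the highest one. *)
Definition alo j := count id (take j ds).
Definition ahi j := ((size ds).+1 - count negb (take j ds))%N.
Definition armP j : 'M[K]_n := diag_mx (\row_k (alo j <= blk k < ahi j)%N%:R).

(** The rows of [G] form a basis of the central space adapted to the flag, and [Gv] is its inverse.
    Coordinates change on the first arrow only; later on the same matrix [armP j.+1] is a projection
    if the arrow points outward and an inclusion if it points inward. *)
Definition armL (G Gv : 'M[K]_n) j : 'M[K]_n :=
  if j is 0 then if nth false ds 0 then Gv *m armP 1 else armP 1 *m G
  else armP j.+1.

Lemma armP_mul j (A : 'M_n) k l :
  (armP j *m A) k l = (alo j <= blk k < ahi j)%N%:R * A k l.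
Proof. by rewrite mul_diag_mx !mxE. Qed.
Lemma mul_armP j (A : 'M_n) k l :
  (A *m armP j) k l = A k l * (alo j <= blk l < ahi j)%N%:R.
Proof. by rewrite mul_mx_diag !mxE. Qed.

Lemma alo_count j : (j <= size ds)%N -> (alo j + count negb (take j ds) = j)%N.
Proof. by move=> js; rewrite -[RHS](size_takel js) -(count_predC id (take j ds)). Qed.

Lemma aloS j : (j < size ds)%N -> alo j.+1 = (alo j + nth false ds j)%N.
Proof.
by move=> js; rewrite /alo (take_nth false) // -cats1 count_cat /= addn0.
Qed.

Lemma ahiS j : (j < size ds)%N -> ahi j.+1 = (ahi j - ~~ nth false ds j)%N.
Proof.
move=> js; rewrite /ahi (take_nth false) // -cats1 count_cat /= addn0.
by rewrite subnDA.
Qed.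

Lemma armP_comm i j : armP i *m armP j = armP j *m armP i.
Proof. exact: diag_mxC. Qed.

Lemma armPP j : (j < size ds)%N -> armP j *m armP j.+1 = armP j.+1.
Proof.
move=> js; apply/matrixP => k l; rewrite armP_mul !mxE aloS // ahiS //.
case: (boolP (_ <= _ < _ - _)%N) => [r|_]; last by rewrite mul0rn mulr0.
by rewrite (_ : (_ <= _ < _)%N = true) ?mul1r //; lia.
Qed.

Lemma armP_idem j : armP j *m armP j = armP j.
Proof.
apply/matrixP => k l; rewrite armP_mul !mxE.
by case: (_ <= _ < _)%N; rewrite ?mul1r // mul0rn mulr0.
Qed.

Hypothesis blk_le : forall k, (blk k <= size ds)%N.

Lemma armP0 : armP 0 = 1%:M.
Proof.
rewrite /armP -diag_const_mx; congr diag_mx; apply/rowP => k.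
by rewrite !mxE /alo /ahi take0 /= subn0 ltnS blk_le.
Qed.

Lemma armL_ends (G Gv : 'M[K]_n) j : (j < size ds)%N ->
  if nth false ds j then
    armP j *m armL G Gv j = armL G Gv j /\ armL G Gv j *m armP j.+1 = armL G Gv j
  else
    armP j.+1 *m armL G Gv j = armL G Gv j /\ armL G Gv j *m armP j = armL G Gv j.
Proof.
case: j => [|j] js; rewrite ?armP0 /armL.
  case: (nth false ds 0); first by split; rewrite ?mul1mx // -mulmxA armP_idem.
  by split; rewrite ?mulmx1 // mulmxA armP_idem.
by case: ifP => _; rewrite armP_idem ?(armP_comm _ j.+1) armPP.
Qed.

(* Every step along the arm forgets one extreme position, and the orientation makes
   it extreme on the side on which g is forced to vanish. *)
Lemma arm_triangular (g : nat -> 'M[K]_n) :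
    (forall j, (j < size ds)%N ->
      if nth false ds j then armP j.+1 *m g j.+1 = g j *m armP j.+1
      else armP j.+1 *m g j = g j.+1 *m armP j.+1) ->
  forall k l, (blk k < blk l)%N -> g 0%N k l = 0.
Proof.
move=> gP k l kl.
(* Descending induction on the level. At the end of the arm a single position is left, [ahi] being
   [alo] + 1, and the claim is vacuous. *)
suff tri j : (j <= size ds)%N -> (alo j <= blk k)%N -> (blk l < ahi j)%N -> g j k l = 0.
  by apply: tri; rewrite // /alo /ahi take0 //= subn0 ltnS.
have [d] := ubnP (size ds - j); elim: d => // d IH in j *; rewrite ltnS => jd js ka la.
have [jp|pj] := ltnP j (size ds); last first.
  by have := alo_count js; rewrite /ahi in la; lia.
have IHj := IH j.+1; have := gP j jp; move: (aloS jp) (ahiS jp).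
case: (nth _ _ _) => /= lo hi /matrixP/(_ k l); rewrite armP_mul mul_armP.
  have -> : (alo j.+1 <= blk l < ahi j.+1)%N by lia.
  rewrite mulr1 => <-; have [ka'|ka'] := ltnP (alo j) (blk k).
    by rewrite IHj ?mulr0 //; lia.
  by rewrite (_ : (alo j.+1 <= blk k)%N = false) ?mul0r //; lia.
have -> : (alo j.+1 <= blk k < ahi j.+1)%N by lia.
rewrite mul1r => ->; have [la'|la'] := ltnP (blk l).+1 (ahi j).
  by rewrite IHj ?mul0r //; lia.
by rewrite (_ : (alo j.+1 <= blk l < ahi j.+1)%N = false) ?mulr0 //; lia.
Qed.

(** Every arrow is a coordinate projection or inclusion, so the component at level j determines the
    one at level j+1. *)
Lemma arm_scalar (g : nat -> 'M[K]_n) c :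
    (forall j, (j < size ds)%N ->
      if nth false ds j then armP j.+1 *m g j.+1 = g j *m armP j.+1
      else armP j.+1 *m g j = g j.+1 *m armP j.+1) ->
    (forall j, (0 < j <= size ds)%N -> armP j *m g j *m armP j = g j) ->
    g 0%N = c%:M ->
  forall j, (j <= size ds)%N -> g j = c *: armP j.
Proof.
move=> gP Pg g0; elim=> [|j IH] js; first by rewrite g0 armP0 scalemx1.
rewrite -Pg //; have := gP j js; rewrite IH 1?ltnW // -scalemxAl armPP //.
case: ifP => _ => [->|].
  by rewrite -scalemxAl armP_idem.
by rewrite -scalemxAr armP_comm armPP // -mulmxA => <-; rewrite -scalemxAr armP_idem.
Qed.

Section Glued.
Variables (Gi Gvi Gj Gvj : 'M[K]_n) (h : nat -> 'M[K]_n).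
Hypotheses (GGvi : Gi *m Gvi = 1%:M) (GGvj : Gj *m Gvj = 1%:M).
Hypothesis hP : forall j, (0 < j <= size ds)%N -> armP j *m h j *m armP j = h j.
Hypothesis hL : forall j, (j < size ds)%N ->
  if nth false ds j then armL Gi Gvi j *m h j.+1 = h j *m armL Gj Gvj j
  else armL Gi Gvi j *m h j = h j.+1 *m armL Gj Gvj j.

(** In the adapted bases of the two bricks the central component becomes [Gi] h(0) [Gvj], and the
    base changes disappear from all equations. *)
Let g j := if j is 0 then Gi *m h 0%N *m Gvj else h j.

Lemma glued_arm j : (j < size ds)%N ->
  if nth false ds j then armP j.+1 *m g j.+1 = g j *m armP j.+1
  else armP j.+1 *m g j = g j.+1 *m armP j.+1.
Proof.
case: j => [|j] js; move: (hL js); rewrite /armL /=; case: (nth _ _ _) => //= e.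
  by rewrite -[Gi *m _ *m _ *m _]mulmxA -mulmxA -e !mulmxA GGvi mul1mx.
by rewrite !mulmxA e -!mulmxA GGvj mulmx1.
Qed.

Lemma glued_arm_triangular k l : (blk k < blk l)%N -> (Gi *m h 0%N *m Gvj) k l = 0.
Proof. exact: (arm_triangular glued_arm). Qed.

Lemma glued_arm_scalar c : h 0%N = c%:M -> (c != 0 -> Gi = Gj) ->
  forall j, (0 < j <= size ds)%N -> h j = c *: armP j.
Proof.
move=> h0 cG j /andP[j0 js].
have := arm_scalar glued_arm _ _ js; rewrite /g; case: j j0 js => // j _ _; apply.
  by case=> [//|l] /hP.
rewrite h0; have [->|/cG->] := eqVneq c 0.
  by rewrite scalar_mx0 mulmx0 mul0mx.
by rewrite scalar_mxC -mulmxA GGvj mulmx1.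
Qed.
End Glued.
End Arm.

(** * Bricks from flags on the arms of a star *)

Section Star.
Variables (K : fieldType) (nv : nat) (E : seq (nat * nat)) (o : nat -> bool) (n : nat).
(** On the core the space is all of K^n and the arrows are identities: one vertex in type E, the
    inner path in type D. Arm [al] starts in the core at [vs al 0], and [es al j] joins its levels j
    and j+1. *)
Variables (core : pred nat) (z : nat).
Variables (na : nat) (vs es : nat -> nat -> nat) (ds : nat -> seq bool).
Variables (bl : nat -> 'I_n -> nat) (G Gv : nat -> 'I_4 -> 'M[K]_n).
Variables (P : nat -> 'M[K]_n) (L : 'I_4 -> nat -> 'M[K]_n).

Hypothesis vert_cover : forall v, (v < nv)%N -> core v \/
  exists al j, [/\ (al < na)%N, (0 < j <= size (ds al))%N & v = vs al j].
Hypothesis edge_cover : forall k, (k < size E)%N ->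
  core (nth (0, 0)%N E k).1 /\ core (nth (0, 0)%N E k).2 \/
  exists al j, [/\ (al < na)%N, (j < size (ds al))%N & k = es al j].
Hypothesis core_conn : forall h : nat -> 'M[K]_n,
  (forall k, (k < size E)%N -> core (nth (0, 0)%N E k).1 ->
    core (nth (0, 0)%N E k).2 -> h (nth (0, 0)%N E k).1 = h (nth (0, 0)%N E k).2) ->
  forall v, (v < nv)%N -> core v -> h v = h z.
Hypothesis core_nv : forall v, core v -> (v < nv)%N.
Hypothesis core_edge : forall k, (k < size E)%N ->
  core (nth (0, 0)%N E k).1 -> core (nth (0, 0)%N E k).2 -> forall i, L i k = 1%:M.
Hypothesis n_gt0 : (0 < n)%N.
Hypothesis vs0 : forall al, (al < na)%N -> core (vs al 0).
Hypothesis vs_nv : forall al j, (al < na)%N -> (j <= size (ds al))%N -> (vs al j < nv)%N.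
Hypothesis es_E : forall al j, (al < na)%N -> (j < size (ds al))%N -> (es al j < size E)%N.
Hypothesis es_ends : forall al j, (al < na)%N -> (j < size (ds al))%N ->
  if nth false (ds al) j
  then esrc o E (es al j) = vs al j /\ etgt o E (es al j) = vs al j.+1
  else esrc o E (es al j) = vs al j.+1 /\ etgt o E (es al j) = vs al j.
Hypothesis P_core : forall v, core v -> P v = 1%:M.
Hypothesis P_arm : forall al j, (al < na)%N -> (0 < j <= size (ds al))%N ->
  P (vs al j) = armP K (bl al) (ds al) j.
Hypothesis L_arm : forall al j i, (al < na)%N -> (j < size (ds al))%N ->
  L i (es al j) = armL (bl al) (ds al) (G al i) (Gv al i) j.
Hypothesis bl_le : forall al k, (al < na)%N -> (bl al k <= size (ds al))%N.
Hypothesis bl_surj : forall al t, (al < na)%N -> (t <= size (ds al))%N ->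
  exists k, bl al k = t.
Hypothesis GGv : forall al i, (al < na)%N -> G al i *m Gv al i = 1%:M.
(** The linear algebra specific to each diagram: a matrix carrying all flags of brick [i] into those
    of brick [j]. *)
Hypothesis rigid : forall i j (h0 : 'M[K]_n),
  (forall al k l, (al < na)%N -> (bl al k < bl al l)%N ->
     (G al i *m h0 *m Gv al j) k l = 0) ->
  exists c, h0 = c%:M /\ (i != j -> c = 0).

Lemma P_arm0 al j : (al < na)%N -> (j <= size (ds al))%N ->
  P (vs al j) = armP K (bl al) (ds al) j.
Proof.
move=> ana; case: j => [|j] js; last exact: P_arm.
by rewrite P_core ?armP0 ?vs0 // => k; apply: bl_le.
Qed.

Lemma armP_nz al j : (al < na)%N -> (j <= size (ds al))%N ->
  armP K (bl al) (ds al) j != 0.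
Proof.
move=> ana js; have lo := alo_count js.
have [|k bk] := @bl_surj al (alo (ds al) j) ana; first by lia.
apply/eqP => /matrixP/(_ k k); rewrite !mxE eqxx mulr1n bk leqnn /ahi.
rewrite (_ : (_ < _)%N) /=; first by move/eqP; rewrite oner_eq0.
by lia.
Qed.

Lemma star_brickfam :
  [/\ forall k, (k < nv)%N -> P k *m P k = P k /\ P k != 0,
      forall i k, (k < size E)%N ->
        P (esrc o E k) *m L i k = L i k /\ L i k *m P (etgt o E k) = L i k
    & forall i j (h : nat -> 'M[K]_n),
        (forall k, (k < nv)%N -> P k *m h k *m P k = h k) ->
        (forall k, (k < size E)%N ->
          L i k *m h (etgt o E k) = h (esrc o E k) *m L j k) ->
        if i == j then exists c, forall k, (k < nv)%N -> h k = c *: P k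
        else forall k, (k < nv)%N -> h k = 0].
Proof.
split.
- move=> v /vert_cover[cv|[al [j [ana /andP[j0 js] ->]]]].
    rewrite P_core // mulmx1; split=> //; apply/eqP => /matrixP.
    move/(_ (Ordinal n_gt0) (Ordinal n_gt0)); rewrite !mxE eqxx.
    by move/eqP; rewrite oner_eq0.
  by rewrite P_arm0 // armP_idem armP_nz.
- move=> i k kE; have [[c1 c2]|[al [j [ana js ->]]]] := edge_cover kE.
    by rewrite core_edge // mulmx1 mul1mx /esrc /etgt; case: ifP => _; rewrite !P_core.
  have := es_ends ana js; have := armL_ends (fun k => bl_le k ana) (G al i) (Gv al i) js.
  by case: ifP => _ [e1 e2] [-> ->]; rewrite !P_arm0 ?(ltnW js) // L_arm.
move=> i j h hP hL.
have hz v : core v -> h v = h z.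
  move=> cv; apply: core_conn (core_nv cv) (cv) => k kE c1 c2.
  have := hL k kE; rewrite !core_edge // mul1mx mulmx1 /esrc /etgt.
  by case: ifP.
have hLa al l : (al < na)%N -> (l < size (ds al))%N ->
    if nth false (ds al) l then
      armL (bl al) (ds al) (G al i) (Gv al i) l *m h (vs al l.+1) =
      h (vs al l) *m armL (bl al) (ds al) (G al j) (Gv al j) l
    else armL (bl al) (ds al) (G al i) (Gv al i) l *m h (vs al l) =
      h (vs al l.+1) *m armL (bl al) (ds al) (G al j) (Gv al j) l.
  move=> ana ls; have := hL _ (es_E ana ls); have := es_ends ana ls.
  by rewrite !L_arm //; case: ifP => _ [-> ->].
have [c [hc c0]] : exists c, h z = c%:M /\ (i != j -> c = 0).
  apply: rigid => al k l ana kl; rewrite -(hz _ (vs0 ana)).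
  exact: (glued_arm_triangular (fun k => bl_le k ana) (GGv i ana) (GGv j ana) (h := h \o vs al)
    (fun t => hLa al t ana) kl).
have {}hc v : (v < nv)%N -> h v = c *: P v.
  move=> vn; have [cv|[al [t [ana ts ->]]]] := vert_cover vn.
    by rewrite hz // hc P_core // scalemx1.
  rewrite P_arm //.
  apply: (glued_arm_scalar (fun k => bl_le k ana) (GGv i ana) (GGv j ana) (h := h \o vs al)
    _ (fun t => hLa al t ana)) ts => //=.
  - move=> l /andP[l0 ls]; rewrite -P_arm ?l0 ?ls //; apply: hP.
    exact: vs_nv.
  - by rewrite hz ?vs0.
  - by move=> cn; have [->//|/c0 c00] := eqVneq i j; rewrite c00 eqxx in cn.
case: eqVneq => [_|/c0 c00]; first by exists c.
by move=> k kn; rewrite hc // c00 scale0r.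
Qed.
End Star.

Definition mxl (K : fieldType) n (s : seq (seq K)) : 'M[K]_n :=
  \matrix_(i, j) nth 0 (nth [::] s i) j.

(** A sum that [/=] expands into explicit terms, so that entries of products of listed matrices
    become goals for [ring]. *)
Definition sumr (K : nmodType) (n : nat) (F : nat -> K) : K :=
  foldr (fun k => +%R (F k)) 0 (iota 0 n).

Lemma sumr_ord (K : nmodType) n (F : nat -> K) : \sum_(i < n) F i = sumr n F.
Proof. by rewrite /sumr -(big_mkord xpredT F) /index_iota subn0 unlock. Qed.

Definition list_entry (K : nmodType) (s : seq (seq K)) i j := nth 0 (nth [::] s i) j.

Lemma mul_mxlE (K : fieldType) n (s t : seq (seq K)) (i j : 'I_n) :
  (mxl n s *m mxl n t) i j = sumr n (fun k => list_entry s i k * list_entry t k j).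
Proof. by rewrite mxE -sumr_ord; apply: eq_bigr => k _; rewrite !mxE. Qed.

Lemma mul3_mxlE (K : fieldType) n (s t u : seq (seq K)) (i j : 'I_n) :
  (mxl n s *m mxl n t *m mxl n u) i j =
  sumr n (fun k => sumr n (fun l => list_entry s i l * list_entry t l k) * list_entry u k j).
Proof. by rewrite mxE -sumr_ord; apply: eq_bigr => k _; rewrite mul_mxlE mxE. Qed.

(** Orthogonality in every family ends here: a morphism acts by [c] and intertwines two different
    parameters. *)
Lemma scalar_free (K : fieldType) (I : eqType) (lam : I -> K) i j c :
  injective lam -> lam i * c = c * lam j -> i != j -> c = 0.
Proof.
move=> inj e ij; apply/eqP; apply: contraNT ij => c0; apply/eqP/inj.
by apply: (mulIf c0); rewrite e mulrC.
Qed.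

Lemma eq_of_subr (R : zmodType) (x y z : R) : z = 0 -> x - y = z -> x = y.
Proof. by move=> -> /eqP; rewrite subr_eq0 => /eqP. Qed.

Section Families.
Variables (K : fieldType) (lam : 'I_4 -> K).
Hypothesis lam_inj : injective lam.

(** Lines joined by identities, except for the parameter on the closing edge. A zero parameter is
    harmless: the other edges already identify all components. *)
Lemma a_brickfam m : brickfam K m.+1 (a_E m).
Proof.
move=> o; exists 1%N, (fun=> 1%:M), (fun i k => if k == m then (lam i)%:M else 1%:M).
split=> [k _|i k _|i j h _ hL].
- by rewrite mulmx1; split=> //; apply/eqP => /matrixP/(_ 0 0)/eqP; rewrite !mxE oner_eq0.
- by rewrite mul1mx mulmx1.
have sE : size (a_E m) = m.+1 by rewrite size_rcons size_path_edges.
have hS k : (k <= m)%N -> h k = h 0%N.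
  elim: k => // k IH km; rewrite -IH 1?ltnW //.
  have := hL k; rewrite sE ltnS ltnW // => /(_ isT).
  rewrite (ltn_eqF km) /etgt /esrc nth_rcons size_path_edges km nth_path_edges //=.
  by case: (o k); rewrite mul1mx mulmx1.
have h0 : h 0%N = (h 0%N 0 0)%:M by rewrite [LHS]mx11_scalar.
suff c0 : i != j -> h 0%N 0 0 = 0.
  have hc k : (k < m.+1)%N -> h k = h 0%N 0 0 *: 1%:M.
    by rewrite ltnS => /hS->; rewrite {1}h0 scalemx1.
  case: eqVneq => [_|/c0 h00]; first by exists (h 0%N 0 0).
  by move=> k /hc->; rewrite h00 scale0r.
apply: scalar_free lam_inj _; have := hL m; rewrite sE ltnSn => /(_ isT).
rewrite eqxx /etgt /esrc nth_rcons size_path_edges ltnn eqxx /=.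
have -> : h (if o m then 0 else m)%N = h 0%N by case: (o m); rewrite ?hS.
have -> : h (if o m then m else 0)%N = h 0%N by case: (o m); rewrite ?hS.
by move/matrixP/(_ 0 0); rewrite h0 !mxE !big_ord1 !mxE.
Qed.

Section D.
Variables (m : nat) (o : nat -> bool).
Definition d_core : pred nat := [pred v | 1 <= v <= m.+1]%N.
Definition d_bl (al : nat) (k : 'I_2) : nat := (if al is 1 then 1 - k else k)%N.
(** A bit is negated exactly when the edge lists its outer end first, here edge 0; likewise for the
    types E below. *)
Definition d_ds al := [:: nth false [:: ~~ o 0; o m.+3; o m.+1; o m.+2]%N al].
Definition d_vs al j := nth 0%N
  (nth [::] [:: [:: 1; 0]; [:: 1; m.+4]; [:: m.+1; m.+2]; [:: m.+1; m.+3]]%N al) j.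
Definition d_es al (j : nat) := nth 0%N [:: 0; m.+3; m.+1; m.+2]%N al.
(** Four lines in the plane: e_0, e_1, e_0 + e_1 and e_0 + lam e_1, given by the basis vectors in
    position 0. The first three already force a scalar; the fourth separates the bricks. *)
Definition d_G al i : 'M[K]_2 :=
  match al with
  | 2 => mxl 2 [:: [:: 1; 1]; [:: 0; 1]]
  | 3 => mxl 2 [:: [:: 1; lam i]; [:: 0; 1]]
  | _ => 1%:M
  end.
Definition d_Gv al i : 'M[K]_2 :=
  match al with
  | 2 => mxl 2 [:: [:: 1; -1]; [:: 0; 1]]
  | 3 => mxl 2 [:: [:: 1; - lam i]; [:: 0; 1]]
  | _ => 1%:M
  end.
Definition d_P v : 'M[K]_2 :=
  let A al := armP K (d_bl al) (d_ds al) 1 in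
  if d_core v then 1%:M else if v == 0%N then A 0%N else if v == m.+4 then A 1%N
  else if v == m.+2 then A 2%N else A 3%N.
Definition d_L i k : 'M[K]_2 :=
  let A al := armL (d_bl al) (d_ds al) (d_G al i) (d_Gv al i) 0 in
  if k == 0%N then A 0%N else if k == m.+3 then A 1%N else if k == m.+1 then A 2%N
  else if k == m.+2 then A 3%N else 1%:M.

Lemma d_rigid i j (h : 'M[K]_2) :
  (forall al k l, (al < 4)%N -> (d_bl al k < d_bl al l)%N ->
     (d_G al i *m h *m d_Gv al j) k l = 0) ->
  exists c, h = c%:M /\ (i != j -> c = 0).
Proof.
move=> hz.
have hd k l : k != l -> h k l = 0.
  rewrite neq_ltn => /orP[kl|lk].
    by have := hz 0%N k l isT kl; rewrite mul1mx mulmx1.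
  have := hz 1%N k l isT; rewrite mul1mx mulmx1; apply.
  by move: (ltn_ord k) (ltn_ord l) lk; rewrite /d_bl /=; lia.
pose a := h 0 0; pose b := h 1 1.
have hE : h = mxl 2 [:: [:: a; 0]; [:: 0; b]].
  apply/matrixP; case=> [[|[|//]] ?] [[|[|//]] ?]; rewrite mxE /=;
  try (by apply: hd); by congr (h _ _); apply: val_inj.
move: (hz 2%N 0 1 isT isT) (hz 3%N 0 1 isT isT).
rewrite {1 2}hE !mul3_mxlE /sumr /list_entry /= => z z'.
have ba : b = a by apply: (eq_of_subr z); ring.
exists a; split.
  by rewrite hE ba; apply/matrixP; case=> [[|[|//]] ?] [[|[|//]] ?]; rewrite !mxE.
apply: scalar_free lam_inj _; rewrite ba in z'.
by apply: (eq_of_subr z'); ring.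
Qed.
End D.

Lemma d_brickfam m : brickfam K m.+4.+1 (d_E m).
Proof.
move=> o; exists 2%N, (d_P m o), (d_L m o).
apply: (@star_brickfam K m.+4.+1 (d_E m) o 2 (d_core m) 1 4
  (d_vs m) (d_es m) (d_ds m o) d_bl d_G d_Gv); rewrite ?size_d_E.
- move=> v vm; have [cv|ncv] := boolP (d_core m v); [by left | right].
  have [->|v0] := eqVneq v 0%N; first by exists 0%N, 1%N.
  have [->|v4] := eqVneq v m.+4; first by exists 1%N, 1%N.
  have [->|v2] := eqVneq v m.+2; first by exists 2%N, 1%N.
  by exists 3%N, 1%N; split=> //; move: ncv; rewrite /d_core /d_vs /=; lia.
- move=> k km; rewrite nth_d_E.
  have [->|k0] := eqVneq k 0%N; first by right; exists 0%N, 0%N.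
  have [->|k3] := eqVneq k m.+3; first by right; exists 1%N, 0%N.
  have [->|k1] := eqVneq k m.+1; first by right; exists 2%N, 0%N.
  have [->|k2] := eqVneq k m.+2; first by right; exists 3%N, 0%N.
  by left; rewrite (_ : (k < m.+2)%N) /d_core /=; lia.
- move=> h hE; elim=> // -[//|v] IH _ cv; rewrite -IH; try by move: cv; rewrite /d_core /=; lia.
  have := hE v.+1; rewrite nth_d_E.
  have v2 : (v.+1 < m.+2)%N by move: cv; rewrite /d_core /=; lia.
  rewrite v2 /= => <- //; move: cv; rewrite /d_core /=; lia.
- by move=> v; rewrite /d_core /=; lia.
- move=> k km; rewrite nth_d_E /d_core /d_L /=.
  case: (ltnP k m.+2) => [k2|k2] /=; last first.
    case: eqP => _; [|case: eqP => _] => /= c1 c2; exfalso; lia.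
  move=> c1 c2 i.
  have [k0 k3 k1 k4] : [/\ k != 0, k != m.+3, k != m.+1 & k != m.+2]%N by split; lia.
  by rewrite (negPf k0) (negPf k3) (negPf k1) (negPf k4).
- by [].
- by case=> [|[|[|[|//]]]] _; rewrite /d_core /d_vs /=; lia.
- by case=> [|[|[|[|//]]]] [|[|//]] _ _; rewrite /d_vs /=; lia.
- by case=> [|[|[|[|//]]]] [|//] _ _; rewrite /d_es /=; lia.
- case=> [|[|[|[|//]]]] [|//] _ _; rewrite /esrc /etgt /d_ds /d_es /d_vs nth_d_E /=.
  + by case: (o 0%N).
  + by rewrite ltnNge leqnSn /= eqn_leq ltnn /= eqxx; case: (o _).
  + by rewrite ltnSn; case: (o _).
  + by rewrite ltnn eqxx; case: (o _).
- by move=> v cv; rewrite /d_P cv.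
- case=> [|[|[|[|//]]]] [//|[|//]] _ _; rewrite /d_P /d_core /d_vs /=.
  + by [].
  + have e1 : (m.+4 <= m.+1)%N = false by lia.
    by rewrite e1 eqxx.
  + have e1 : (m.+2 == m.+4) = false by lia.
    by rewrite ltnn e1 eqxx.
  + have [e1 e2 e3] : [/\ (m.+3 <= m.+1)%N = false, (m.+3 == m.+4) = false
      & (m.+3 == m.+2) = false] by split; lia.
    by rewrite e1 e2 e3.
- case=> [|[|[|[|//]]]] [|//] i _ _; rewrite /d_L /d_es /=.
  + by [].
  + by rewrite eqxx.
  + have e1 : (m.+1 == m.+3) = false by lia.
    by rewrite e1 eqxx.
  + have [e1 e2] : (m.+2 == m.+3) = false /\ (m.+2 == m.+1) = false by split; lia.
    by rewrite e1 e2 eqxx.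
- by case=> [|[|[|[|//]]]] [[|[|//]] ?].
- by case=> [|[|[|[|//]]]] [|[|//]] _ _; first
    [by exists (@Ordinal 2 0 isT) | by exists (@Ordinal 2 1 isT)].
- case=> [|[|[|[|//]]]] i _; rewrite /d_G /d_Gv; try exact: mulmx1.
  1,2: apply/matrixP; case=> [[|[|//]] ?] [[|[|//]] ?];
    rewrite mul_mxlE /sumr /list_entry mxE /=; ring.
- exact: d_rigid.
Qed.

Section E6.
Variable o : nat -> bool.
Definition e6_bl (al : nat) (k : 'I_3) : nat := if al is 1 then (2 - k)%N else k.
Definition e6_ds al := nth [::] [:: [:: ~~ o 1; ~~ o 0]; [:: o 2; o 3]; [:: o 4; o 5]] al.
Definition e6_vs al j := nth 0%N (nth [::] [:: [:: 2; 1; 0]; [:: 2; 3; 4]; [:: 2; 5; 6]]%N al) j.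
Definition e6_es al j := nth 0%N (nth [::] [:: [:: 1; 0]; [:: 2; 3]; [:: 4; 5]]%N al) j.
(** Three full flags in K^3. The first two are opposite, which makes [h] diagonal. The third has the
    line of e_0 + e_1 + e_2, which makes [h] scalar, and a plane that also contains e_1 + lam e_2
    and detects the parameter. *)
Definition e6_G al i : 'M[K]_3 :=
  if al is 2 then mxl 3 [:: [:: 1; 1; 1]; [:: 0; 1; lam i]; [:: 0; 0; 1]] else 1%:M.
Definition e6_Gv al i : 'M[K]_3 :=
  if al is 2 then mxl 3 [:: [:: 1; -1; lam i - 1]; [:: 0; 1; - lam i]; [:: 0; 0; 1]]
  else 1%:M.
Definition e6_P v : 'M[K]_3 :=
  let A al := armP K (e6_bl al) (e6_ds al) in
  nth 0 [:: A 0 2; A 0 1; 1%:M; A 1 1; A 1 2; A 2 1; A 2 2]%N v.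
Definition e6_L i k : 'M[K]_3 :=
  let A al := armL (e6_bl al) (e6_ds al) (e6_G al i) (e6_Gv al i) in
  nth 0 [:: A 0 1; A 0 0; A 1 0; A 1 1; A 2 0; A 2 1]%N k.

Lemma e6_rigid i j (h : 'M[K]_3) :
  (forall al k l, (al < 3)%N -> (e6_bl al k < e6_bl al l)%N ->
     (e6_G al i *m h *m e6_Gv al j) k l = 0) ->
  exists c, h = c%:M /\ (i != j -> c = 0).
Proof.
move=> hz.
have hd k l : k != l -> h k l = 0.
  rewrite neq_ltn => /orP[kl|lk].
    by have := hz 0%N k l isT kl; rewrite mul1mx mulmx1.
  have := hz 1%N k l isT; rewrite mul1mx mulmx1; apply.
  move: (ltn_ord k) (ltn_ord l) lk; rewrite /e6_bl /=. lia.
pose a := h 0 0; pose b := h 1 1; pose c := h 2 2.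
have hE : h = mxl 3 [:: [:: a; 0; 0]; [:: 0; b; 0]; [:: 0; 0; c]].
  apply/matrixP; case=> [[|[|[|//]]] ?] [[|[|[|//]]] ?]; rewrite mxE /=;
  try (by apply: hd); by congr (h _ _); apply: val_inj.
have z01 := hz 2%N 0 1 isT isT; have z02 := hz 2%N 0 2 isT isT.
have z12 := hz 2%N 1 2 isT isT.
move: z01 z02 z12.
rewrite {1 2 3}hE !mul3_mxlE /sumr /list_entry /=.
move=> z01 z02 z12.
have ba : b = a by apply: (eq_of_subr z01); ring.
have ca : c = a by rewrite ba in z02; apply: (eq_of_subr z02); ring.
exists a; split.
  by rewrite hE ba ca; apply/matrixP; case=> [[|[|[|//]]] ?] [[|[|[|//]]] ?]; rewrite !mxE.
apply: scalar_free lam_inj _; rewrite ba ca in z12.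
by apply: (eq_of_subr z12); ring.
Qed.

End E6.

Lemma e6_brickfam : brickfam K 7 e6_E.
Proof.
move=> o; exists 3%N, (e6_P o), (e6_L o).
apply: (@star_brickfam K 7 e6_E o 3 (pred1 2%N) 2 3
  e6_vs e6_es (e6_ds o) e6_bl e6_G e6_Gv).
- case=> [|[|[|[|[|[|[|//]]]]]]] _; [right; exists 0%N, 2%N | right; exists 0%N, 1%N | by left
  | right; exists 1%N, 1%N | right; exists 1%N, 2%N | right; exists 2%N, 1%N | right; exists 2%N, 2%N]; by [].
- case=> [|[|[|[|[|[|//]]]]]] _; right; [exists 0%N, 1%N | exists 0%N, 0%N
  | exists 1%N, 0%N | exists 1%N, 1%N | exists 2%N, 0%N | exists 2%N, 1%N]; by [].
- by move=> h _ v _ /eqP->.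
- by move=> v /eqP->.
- by case=> [|[|[|[|[|[|//]]]]]].
- by [].
- by case=> [|[|[|//]]].
- by case=> [|[|[|//]]] [|[|[|//]]].
- by case=> [|[|[|//]]] [|[|//]].
- by case=> [|[|[|//]]] [|[|//]] _ _ /=; rewrite /esrc /etgt /=; case: (o _).
- by move=> v /eqP->.
- by case=> [|[|[|//]]] [|[|[|//]]].
- by case=> [|[|[|//]]] [|[|//]].
- by case=> [|[|[|//]]] [[|[|[|//]]] ?].
- by case=> [|[|[|//]]] [|[|[|//]]] _ _; first
    [by exists (@Ordinal 3 0 isT) | by exists (@Ordinal 3 1 isT) | by exists (@Ordinal 3 2 isT)].
- case=> [|[|[|//]]] i _; rewrite /e6_G /e6_Gv ?mulmx1 //.
  apply/matrixP; case=> [[|[|[|//]]] ?] [[|[|[|//]]] ?];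
  rewrite mul_mxlE /sumr /list_entry mxE /=; ring.
- exact: e6_rigid.
Qed.

Section E7.
Variable o : nat -> bool.
Definition e7_bl (al : nat) (k : 'I_4) : nat :=
  match al with 0 => k | 1 => 3 - k | _ => k./2 end%N.
Definition e7_ds al := nth [::]
  [:: [:: ~~ o 2; ~~ o 1; ~~ o 0]; [:: o 3; o 4; o 5]; [:: o 6]] al.
Definition e7_vs al j := nth 0%N
  (nth [::] [:: [:: 3; 2; 1; 0]; [:: 3; 4; 5; 6]; [:: 3; 7]]%N al) j.
Definition e7_es al j := nth 0%N (nth [::] [:: [:: 2; 1; 0]; [:: 3; 4; 5]; [:: 6]]%N al) j.
Definition e7_G al i : 'M[K]_4 :=
  if al is 2 then mxl 4 [:: [:: 1; 0; 1; 1]; [:: 0; 1; 1; lam i];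
    [:: 0; 0; 1; 0]; [:: 0; 0; 0; 1]] else 1%:M.
Definition e7_Gv al i : 'M[K]_4 :=
  if al is 2 then mxl 4 [:: [:: 1; 0; -1; -1]; [:: 0; 1; -1; - lam i];
    [:: 0; 0; 1; 0]; [:: 0; 0; 0; 1]] else 1%:M.
Definition e7_P v : 'M[K]_4 :=
  let A al := armP K (e7_bl al) (e7_ds al) in
  nth 0 [:: A 0 3; A 0 2; A 0 1; 1%:M; A 1 1; A 1 2; A 1 3; A 2 1]%N v.
Definition e7_L i k : 'M[K]_4 :=
  let A al := armL (e7_bl al) (e7_ds al) (e7_G al i) (e7_Gv al i) in
  nth 0 [:: A 0 2; A 0 1; A 0 0; A 1 0; A 1 1; A 1 2; A 2 0]%N k.

(* The two long arms make h diagonal; the plane of e_0 + e_2 + e_3 and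
   e_1 + e_2 + lam e_3 compares its entries along a square with monodromy lam. *)
Lemma e7_rigid i j (h : 'M[K]_4) :
  (forall al k l, (al < 3)%N -> (e7_bl al k < e7_bl al l)%N ->
     (e7_G al i *m h *m e7_Gv al j) k l = 0) ->
  exists c, h = c%:M /\ (i != j -> c = 0).
Proof.
move=> hz.
have hd k l : k != l -> h k l = 0.
  rewrite neq_ltn => /orP[kl|lk].
    by have := hz 0%N k l isT kl; rewrite mul1mx mulmx1.
  have := hz 1%N k l isT; rewrite mul1mx mulmx1; apply.
  by move: (ltn_ord k) (ltn_ord l) lk; rewrite /e7_bl /=; lia.
pose a := h 0 0; pose b := h 1 1; pose c := h 2 2; pose d := h 3 3.
have hE : h = mxl 4 [:: [:: a; 0; 0; 0]; [:: 0; b; 0; 0]; [:: 0; 0; c; 0]; [:: 0; 0; 0; d]].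
  apply/matrixP; case=> [[|[|[|[|//]]]] ?] [[|[|[|[|//]]]] ?]; rewrite mxE /=;
  try (by apply: hd); by congr (h _ _); apply: val_inj.
move: (hz 2%N 0 2 isT isT) (hz 2%N 0 3 isT isT) (hz 2%N 1 2 isT isT) (hz 2%N 1 3 isT isT).
rewrite {1 2 3 4}hE !mul3_mxlE /sumr /list_entry /=.
move=> z02 z03 z12 z13.
have ca : c = a by apply: (eq_of_subr z02); ring.
have da : d = a by apply: (eq_of_subr z03); ring.
have ba : b = a by apply/esym; rewrite -{1}ca; apply: (eq_of_subr z12); ring.
exists a; split.
  rewrite hE ba ca da; apply/matrixP.
  by case=> [[|[|[|[|//]]]] ?] [[|[|[|[|//]]]] ?]; rewrite !mxE.
apply: scalar_free lam_inj _; rewrite ba da in z13.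
by apply: (eq_of_subr z13); ring.
Qed.
End E7.

Lemma e7_brickfam : brickfam K 8 e7_E.
Proof.
move=> o; exists 4%N, (e7_P o), (e7_L o).
apply: (@star_brickfam K 8 e7_E o 4 (pred1 3%N) 3 3
  e7_vs e7_es (e7_ds o) e7_bl e7_G e7_Gv).
- case=> [|[|[|[|[|[|[|[|//]]]]]]]] _; [right; exists 0%N, 3%N | right; exists 0%N, 2%N
  | right; exists 0%N, 1%N | by left | right; exists 1%N, 1%N | right; exists 1%N, 2%N
  | right; exists 1%N, 3%N | right; exists 2%N, 1%N]; by [].
- case=> [|[|[|[|[|[|[|//]]]]]]] _; right; [exists 0%N, 2%N | exists 0%N, 1%N | exists 0%N, 0%N
  | exists 1%N, 0%N | exists 1%N, 1%N | exists 1%N, 2%N | exists 2%N, 0%N]; by [].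
- by move=> h _ v _ /eqP->.
- by move=> v /eqP->.
- by case=> [|[|[|[|[|[|[|//]]]]]]].
- by [].
- by case=> [|[|[|//]]].
- by case=> [|[|[|//]]] [|[|[|[|//]]]].
- by case=> [|[|[|//]]] [|[|[|//]]].
- by case=> [|[|[|//]]] [|[|[|//]]] _ _ //=; rewrite /esrc /etgt /=; case: (o _).
- by move=> v /eqP->.
- by case=> [|[|[|//]]] [|[|[|[|//]]]].
- by case=> [|[|[|//]]] [|[|[|//]]].
- by case=> [|[|[|//]]] [[|[|[|[|//]]]] ?].
- by case=> [|[|[|//]]] [|[|[|[|//]]]] _ _ //; first
    [ by exists (@Ordinal 4 0 isT) | by exists (@Ordinal 4 1 isT)
    | by exists (@Ordinal 4 2 isT) | by exists (@Ordinal 4 3 isT)].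
- case=> [|[|[|//]]] i _; rewrite /e7_G /e7_Gv ?mulmx1 //.
  apply/matrixP; case=> [[|[|[|[|//]]]] ?] [[|[|[|[|//]]]] ?];
  rewrite mul_mxlE /sumr /list_entry mxE /=; ring.
- exact: e7_rigid.
Qed.

Section E8.
Variable o : nat -> bool.
Definition e8_bl (al : nat) (k : 'I_6) : nat :=
  match al with 0 => k | 1 => (5 - k)./2 | _ => k %/ 3 end%N.
Definition e8_ds al := nth [::]
  [:: [:: o 2; o 3; o 4; o 5; o 6]; [:: ~~ o 1; ~~ o 0]; [:: o 7]] al.
Definition e8_vs al j := nth 0%N
  (nth [::] [:: [:: 2; 3; 4; 5; 6; 7]; [:: 2; 1; 0]; [:: 2; 8]]%N al) j.
Definition e8_es al j := nth 0%N
  (nth [::] [:: [:: 2; 3; 4; 5; 6]; [:: 1; 0]; [:: 7]]%N al) j.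
Definition e8_G al i : 'M[K]_6 :=
  if al is 2 then mxl 6 [:: [:: 0; 1; lam i; 0; 1; 0]; [:: 1; 0; 0; 1; 1; 0];
    [:: 1; 0; 1; 0; 0; 1]; [:: 1; 0; 0; 0; 0; 0]; [:: 0; 0; 1; 0; 0; 0];
    [:: 0; 0; 0; 0; 1; 0]] else 1%:M.
Definition e8_Gv al i : 'M[K]_6 :=
  if al is 2 then mxl 6 [:: [:: 0; 0; 0; 1; 0; 0]; [:: 1; 0; 0; 0; - lam i; -1];
    [:: 0; 0; 0; 0; 1; 0]; [:: 0; 1; 0; -1; 0; -1]; [:: 0; 0; 0; 0; 0; 1];
    [:: 0; 0; 1; -1; -1; 0]] else 1%:M.
Definition e8_P v : 'M[K]_6 :=
  let A al := armP K (e8_bl al) (e8_ds al) in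
  nth 0 [:: A 1 2; A 1 1; 1%:M; A 0 1; A 0 2; A 0 3; A 0 4; A 0 5; A 2 1]%N v.
Definition e8_L i k : 'M[K]_6 :=
  let A al := armL (e8_bl al) (e8_ds al) (e8_G al i) (e8_Gv al i) in
  nth 0 [:: A 1 1; A 1 0; A 0 0; A 0 1; A 0 2; A 0 3; A 0 4; A 2 0]%N k.

(* The two long arms leave h block diagonal with lower triangular 2x2 blocks.  The
   third subspace has the basis e_1 + lam e_2 + e_4, e_3 + e_0 + e_4, e_5 + e_0 + e_2;
   it compares the diagonal entries of h along a hexagon with monodromy lam. *)
Lemma e8_rigid i j (h : 'M[K]_6) :
  (forall al k l, (al < 3)%N -> (e8_bl al k < e8_bl al l)%N ->
     (e8_G al i *m h *m e8_Gv al j) k l = 0) ->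
  exists c, h = c%:M /\ (i != j -> c = 0).
Proof.
move=> hz.
have hz0 (k l : 'I_6) : (k < l)%N -> h k l = 0.
  by move=> kl; have := hz 0%N k l isT kl; rewrite mul1mx mulmx1.
have hz1 (k l : 'I_6) : ((5 - k)./2 < (5 - l)./2)%N -> h k l = 0.
  by move=> kl; have := hz 1%N k l isT kl; rewrite mul1mx mulmx1.
pose a := h 0 0; pose b := h 1 1; pose c := h 2 2; pose d := h 3 3.
pose e := h 4 4; pose f := h 5 5; pose x := h 1 0; pose y := h 3 2; pose z := h 5 4.
have hE : h = mxl 6 [:: [:: a; 0; 0; 0; 0; 0]; [:: x; b; 0; 0; 0; 0];
    [:: 0; 0; c; 0; 0; 0]; [:: 0; 0; y; d; 0; 0]; [:: 0; 0; 0; 0; e; 0];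
    [:: 0; 0; 0; 0; z; f]].
  apply/matrixP; case=> [[|[|[|[|[|[|//]]]]]] ?] [[|[|[|[|[|[|//]]]]]] ?]; rewrite mxE /=;
  first [by apply: hz0 | by apply: hz1 | by congr (h _ _); apply: val_inj].
move: (hz 2%N 0 3 isT isT) (hz 2%N 0 4 isT isT) (hz 2%N 0 5 isT isT)
      (hz 2%N 1 3 isT isT) (hz 2%N 1 4 isT isT) (hz 2%N 1 5 isT isT)
      (hz 2%N 2 3 isT isT) (hz 2%N 2 4 isT isT) (hz 2%N 2 5 isT isT).
rewrite {1 2 3 4 5 6 7 8 9}hE.
rewrite !mul3_mxlE /sumr /list_entry /=.
move=> z03 z04 z05 z13 z14 z15 z23 z24 z25.
have x0 : x = 0 by rewrite -[RHS]z03; ring.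
have y0 : y = 0 by rewrite -[RHS]z14; ring.
have z0 : z = 0 by rewrite -[RHS]z25; ring.
have da : d = a by apply/esym; apply: (eq_of_subr z13); ring.
have ea : e = a by rewrite -da; apply: (eq_of_subr z15); ring.
have ba : b = a by apply/esym; rewrite -{1}ea; apply: (eq_of_subr z05); ring.
have fa : f = a by apply/esym; apply: (eq_of_subr z23); ring.
have ca : c = a by rewrite -fa; apply: (eq_of_subr z24); ring.
exists a; split.
  rewrite hE x0 y0 z0 ba ca da ea fa; apply/matrixP.
  by case=> [[|[|[|[|[|[|//]]]]]] ?] [[|[|[|[|[|[|//]]]]]] ?]; rewrite !mxE.
apply: scalar_free lam_inj _; rewrite ba ca in z04.
by apply: (eq_of_subr z04); ring.
Qed.
End E8.

Lemma e8_brickfam : brickfam K 9 e8_E.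
Proof.
move=> o; exists 6%N, (e8_P o), (e8_L o).
apply: (@star_brickfam K 9 e8_E o 6 (pred1 2%N) 2 3
  e8_vs e8_es (e8_ds o) e8_bl e8_G e8_Gv).
- case=> [|[|[|[|[|[|[|[|[|//]]]]]]]]] _; [right; exists 1%N, 2%N | right; exists 1%N, 1%N
  | by left | right; exists 0%N, 1%N | right; exists 0%N, 2%N | right; exists 0%N, 3%N
  | right; exists 0%N, 4%N | right; exists 0%N, 5%N | right; exists 2%N, 1%N]; by [].
- case=> [|[|[|[|[|[|[|[|//]]]]]]]] _; right; [exists 1%N, 1%N | exists 1%N, 0%N | exists 0%N, 0%N
  | exists 0%N, 1%N | exists 0%N, 2%N | exists 0%N, 3%N | exists 0%N, 4%N | exists 2%N, 0%N]; by [].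
- by move=> h _ v _ /eqP->.
- by move=> v /eqP->.
- by case=> [|[|[|[|[|[|[|[|//]]]]]]]].
- by [].
- by case=> [|[|[|//]]].
- by case=> [|[|[|//]]] [|[|[|[|[|[|//]]]]]].
- by case=> [|[|[|//]]] [|[|[|[|[|//]]]]].
- by case=> [|[|[|//]]] [|[|[|[|[|//]]]]] _ _ //=; rewrite /esrc /etgt /=; case: (o _).
- by move=> v /eqP->.
- by case=> [|[|[|//]]] [|[|[|[|[|[|//]]]]]].
- by case=> [|[|[|//]]] [|[|[|[|[|//]]]]].
- by case=> [|[|[|//]]] [[|[|[|[|[|[|//]]]]]] ?].
- by case=> [|[|[|//]]] [|[|[|[|[|[|//]]]]]] _ _ //; first
    [ by exists (@Ordinal 6 0 isT) | by exists (@Ordinal 6 1 isT)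
    | by exists (@Ordinal 6 2 isT) | by exists (@Ordinal 6 3 isT)
    | by exists (@Ordinal 6 4 isT) | by exists (@Ordinal 6 5 isT)].
- case=> [|[|[|//]]] i _; rewrite /e8_G /e8_Gv ?mulmx1 //.
  apply/matrixP; case=> [[|[|[|[|[|[|//]]]]]] ?] [[|[|[|[|[|[|//]]]]]] ?];
  rewrite mul_mxlE /sumr /list_entry mxE /=; ring.
- exact: e8_rigid.
Qed.

End Families.

(** * Wild quivers *)

Section Final.
Variables (K : fieldType) (Q : quiver).
Hypothesis char0 : [pchar K] =i pred0.
Hypothesis connQ : connected_quiver Q.
Hypothesis acycQ : acyclic_quiver Q.
Hypothesis wildQ : wild Q.

Definition schur_unstable := exists V : rep K Q,
  schur V /\ forall theta : vert Q -> int, ~ stable theta V.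

Definition lam (i : 'I_4) : K := i%:R.

Lemma lam_inj : injective lam.
Proof.
move=> i j; wlog ij : i j / (i <= j)%N => [W|].
  by case/orP: (leq_total i j) => le e; [apply: W | apply/esym/W].
move=> /esym/eqP; rewrite -subr_eq0 -natrB // (pcharf0P K).1 // subn_eq0 => ji.
by apply: val_inj; apply/eqP; rewrite eqn_leq ij.
Qed.

Lemma src_tgt (a : arrow Q) : src a != tgt a.
Proof. by apply/eqP => l; have := acycQ (c := [:: a]); rewrite /= l eqxx => /(_ isT). Qed.

Lemma link_neq x (a : arrow Q) : ~~ link x x a.
Proof.
by apply/negP; case/orP => /andP[/eqP s /eqP t]; have := src_tgt a; rewrite s t eqxx.
Qed.

Lemma tree_case : (forall a : arrow Q, ~~ connect (avoid a) (src a) (tgt a)) ->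
  schur_unstable.
Proof.
move=> tree; have [nv [E [tE [X [B XB]]]]] := tree_has_etree connQ wildQ tree.
have [tlE nvE] := euclidean_tree_treelike tE.
have nv0 : (0 < nv)%N by rewrite nvE.
have [U|[a [k [y [kn l fr]]]]] := embed_exit connQ nv0 XB.
  by case: (wildQ U) => _ []; apply: euclidean_treeE.
apply: (@embed_rep K Q nv E X B y k a) => //.
  by case: tE => *; [apply: (d_brickfam lam_inj) | apply: (e6_brickfam lam_inj)
    | apply: (e7_brickfam lam_inj) | apply: (e8_brickfam lam_inj)].
move: XB kn; rewrite nvE => XB kn.
exact: (tree_fresh tree XB tlE kn l fr).
Qed.

(** Opposite arrows between [x] and [y] would form an oriented cycle. *)
Lemma parallel (x y : vert Q) (a b : arrow Q) : link x y a -> link x y b ->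
  src a = src b /\ tgt a = tgt b.
Proof.
have no (c d : arrow Q) : src c = tgt d -> tgt c = src d -> False.
  by move=> e1 e2; have := acycQ (c := [:: c; d]); rewrite /= e1 e2 !eqxx => /(_ isT).
by case/orP => /andP[/eqP ax /eqP ay] /orP[] /andP[/eqP bx /eqP tgtb];
  rewrite ?ax ?ay ?bx ?tgtb //; case: (no a b); rewrite ?ax ?ay ?bx ?tgtb.
Qed.

Lemma triple_case x y (b1 b2 b3 : arrow Q) : uniq [:: b1; b2; b3] ->
  link x y b1 -> link x y b2 -> link x y b3 -> schur_unstable.
Proof.
move=> u l1 l2 l3; have [s2 t2] := parallel l2 l1; have [s3 t3] := parallel l3 l1.
apply: (@three_arrows_rep K Q (src b1) (tgt b1) b1 b2 b3 u).
  by move=> b; rewrite !inE => /or3P[] /eqP->.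
by move=> b; rewrite !inE => /or3P[] /eqP->.
Qed.

(* The cycle X k, ..., X l closed by the chord a. *)
Lemma subcycle_embed m (X : nat -> vert Q) B k l a : embed m.+1 (a_E m) X B ->
    (k < l <= m)%N -> link (X k) (X l) a -> (forall j, (j <= m)%N -> B j != a) ->
  exists B', embed (l - k).+1 (a_E (l - k)) (fun i => X (k + i)%N) B'.
Proof.
move=> [Xinj Binj BE] klm la fr.
have sE m' : size (a_E m') = m'.+1 by rewrite size_rcons size_path_edges.
exists (fun j => if (j < l - k)%N then B (k + j)%N else a); split.
- by move=> i j; rewrite !inE => ik jk /Xinj e; have := e ltac:(rewrite inE; lia) ltac:(rewrite inE; lia); lia.
- move=> i j; rewrite !inE sE => ik jk.
  have [il|li] := ltnP i (l - k); have [jl|lj] := ltnP j (l - k).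
  + by move/Binj => e; have := e ltac:(rewrite inE sE; lia) ltac:(rewrite inE sE; lia); lia.
  + by move=> e; have := fr (k + i)%N ltac:(lia); rewrite e eqxx.
  + by move=> e; have := fr (k + j)%N ltac:(lia); rewrite -e eqxx.
  + by move=> _; lia.
move=> j; rewrite sE nth_rcons size_path_edges /= => jl.
have [->|nj] := eqVneq j (l - k)%N.
  rewrite ltnn /= addn0 subnKC 1?linkC; last by lia.
  by split=> //; lia.
have {nj}jl : (j < l - k)%N by lia.
have kjE : (k + j < size (a_E m))%N by rewrite sE; lia.
have [_ _] := BE (k + j)%N kjE; have kjm : (k + j < m)%N by lia.
rewrite jl nth_rcons size_path_edges /= kjm !nth_path_edges //= -addnS.
by split=> //; lia.
Qed.

(** If the extra arrow is a chord, the cycle is shortened along it, so that a neighbouring vertex of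
    the old cycle falls outside. *)
Lemma cycle_case m : (0 < m)%N -> has_embed Q m.+1 (a_E m) -> schur_unstable.
Proof.
move=> m0 [X [B XB]]; have [U|[a [k [y [km l fr]]]]] := embed_exit connQ (ltn0Sn _) XB.
  by case: (wildQ U) => _ []; apply: EuclideanA.
have sE : size (a_E m) = m.+1 by rewrite size_rcons size_path_edges.
have fam m' : brickfam K m'.+1 (a_E m') by apply: (a_brickfam lam_inj).
have [/existsP[l0 /eqP Xl]|ny] := boolP [exists j : 'I_m.+1, X j == y]; last first.
  apply: (embed_rep (fam m) XB km _ l) => j jm.
  by move: ny; rewrite negb_exists => /forallP/(_ (Ordinal jm)).
have {}fr j : (j <= m)%N -> B j != a by move=> jm; apply: fr; rewrite sE.
have [Xinj Binj BE] := XB.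
have Xn i j : (i <= m)%N -> (j <= m)%N -> i != j -> X i != X j.
  by move=> im jm; apply: contraNneq => /Xinj ->.
have {y Xl l km}[k' [l' [klm la]]] : exists k' l', (k' < l' <= m)%N /\ link (X k') (X l') a.
  rewrite -Xl in l; have lm := ltn_ord l0.
  have [kl|lk|kl] := ltngtP k l0.
  - by exists k, l0; split=> //; lia.
  - by exists l0, k; rewrite linkC; split=> //; lia.
  - by move: (link_neq (X k) a); rewrite {2}kl l.
have edge j : (j < m)%N -> link (X j) (X j.+1) (B j).
  move=> jm; have jE : (j < size (a_E m))%N by rewrite sE; lia.
  by have [_ _] := BE j jE; rewrite nth_rcons size_path_edges /= jm nth_path_edges.
have closing : link (X m) (X 0) (B m).
  have mE : (m < size (a_E m))%N by rewrite sE.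
  by have [_ _] := BE m mE; rewrite nth_rcons size_path_edges /= ltnn eqxx.
have [B' XB'] := subcycle_embed XB klm la fr.
have [k0|k0] := posnP k'; last first.
  apply: (embed_rep (fam _) XB' (k0 := 0) (w := X k'.-1) (a0 := B k'.-1)) => //.
    by move=> j jl; apply: Xn; lia.
  by rewrite addn0 linkC -{2}(prednK k0); apply: edge; lia.
have [lm|lm] := ltnP l' m.
  apply: (embed_rep (fam _) XB' (k0 := (l' - k')%N) (w := X l'.+1) (a0 := B l')) => //.
    by move=> j jl; apply: Xn; lia.
  by rewrite subnKC ?edge //; lia.
have {lm}lm : l' = m by lia.
(* Here the chord has the same ends as the closing edge, and shortening gains nothing. With only two
   vertices there are three parallel arrows; otherwise the chord and the closing edge form a double
   edge, with [X 1] outside it. *)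
subst k' l'; have [m1|m1] := eqVneq m 1%N.
  subst m; apply: (@triple_case (X 0) (X 1) (B 0) (B 1) a) => //; last first.
  - by rewrite linkC.
  - exact: edge.
  rewrite /= !inE negb_or !fr // !andbT.
  by apply/eqP => /Binj; rewrite !inE sE => /(_ isT isT).
have X0m : X 0%N != X m by apply: Xn; lia.
have XBm : embed 2 (a_E 1) (fun i => if i == 0%N then X 0%N else X m)
    (fun j => if j == 0%N then a else B m).
  split.
  - case=> [|[|//]] [|[|//]] //= _ _ e; first by rewrite e eqxx in X0m.
    by rewrite e eqxx in X0m.
  - case=> [|[|//]] [|[|//]] //= _ _ e; first by have := fr m (leqnn m); rewrite e eqxx.
    by have := fr m (leqnn m); rewrite e eqxx.
  - by case=> [|[|//]] _ /=.
apply: (embed_rep (fam 1%N) XBm (k0 := 0) (w := X 1) (a0 := B 0)) => //=.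
  by move=> [|[|//]] _ /=; apply: Xn; lia.
by apply: edge.
Qed.

Lemma schur_unstable_exists : schur_unstable.
Proof.
have [/existsP[a ca]|] := boolP [exists a : arrow Q, connect (avoid a) (src a) (tgt a)].
  by have [m m0 XB] := cycle_embed (src_tgt a) ca; apply: cycle_case m0 XB.
by rewrite negb_exists => /forallP; apply: tree_case.
Qed.

End Final.

Theorem proposition35 (K : closedFieldType) (char0 : [pchar K] =i pred0)
    (Q : quiver) (connQ : connected_quiver Q) (acycQ : acyclic_quiver Q)
    (wildQ : wild Q) :
  exists V : rep K Q,
    schur V /\ forall theta : vert Q -> int, ~ stable theta V.
Proof. exact: schur_unstable_exists. Qed.
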